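(* Let $T$ be a p-string over $\Sigma\cup\Pi$ whose last symbol is a sentinel $\$\in\Sigma$ occurring nowhere else in $T$, and let $P$ be a p-string of length $m$. Given $\mathsf{PLST}(T)$ (with its stored data, including fast links), one can decide in $O(m)$ time whether $T$ has a substring that p-matches $P$.
   Context: $\Sigma$ (constant symbols) and $\Pi$ (parameter symbols) are disjoint alphabets of constant size; a p-string is a string over $\Sigma\cup\Pi$. Two p-strings $w_1,w_2$ of equal length p-match if there is a bijection $f$ on $\Sigma\cup\Pi$ with $f(a)=a$ for all $a\in\Sigma$ and $f(w_1[i])=w_2[i]$ for all $i$. For a string $w$: $|w|$ is its length, $w[i]$ its $i$-th symbol ($1$-indexed), $w[i:j]$ the substring from $i$ to $j$ ($=\varepsilon$ if $i>j$), $w[i:]=w[i:|w|]$. For strings $u$ and $uv$, $\mathrm{str}(u,uv)=v$. $\mathbb{N}$ denotes the non-negative integers. Prev-encoding: $\mathrm{pre}(w)$ has length $|w|$ with $\mathrm{pre}(w)[i]=w[i]$ if $w[i]\in\Sigma$; $=0$ if $w[i]\in\Pi$ does not occur in $w[1:i-1]$; $=i-k$ with $k=\max\{j<i:w[j]=w[i]\}$ otherwise. Strings over $\Sigma\cup\mathbb{N}$ are pv-strings. For a pv-string $u$ and $k\ge1$, $\langle u\rangle_k$ has length $|u|$, $\langle u\rangle_k[i]=0$ if $u[i]\in\mathbb{N}$ and $u[i]\ge i-k+1$, else $u[i]$; $\langle u\rangle=\langle u\rangle_1$; for nonempty $u$, $\mathsf{sl}(u)=\langle u[2:]\rangle$.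 $\mathsf{PrevSub}(T)=\{\mathrm{pre}(w): w\text{ a substring of }T\}$; $\mathsf{PSTrie}(T)$ is the trie on $\mathsf{PrevSub}(T)$ with root $\varepsilon$ and edges $u\to ua$. Type 1 nodes: leaves and branching nodes (at least two children) of $\mathsf{PSTrie}(T)$, including the root. Type 2 nodes: $u$ not Type 1 with $\mathsf{sl}(u)$ Type 1. $\mathsf{PLST}(T)$ has node set $V$ = Type 1 $\cup$ Type 2 nodes, and an edge $(u,uv)$ iff $v\ne\varepsilon$ and no proper nonempty prefix $v'$ of $v$ has $uv'\in V$; $\mathsf{child}(u,a)$ denotes the child $v$ of $u$ with $\mathrm{str}(u,v)[1]=a$. A node $u\in V$ is good if $u\neq\varepsilon$ and $\mathsf{sl}(u)\in V$, bad otherwise. For non-root $v$ with parent $u$, $\mathsf{Re}(v)=i-|u|$ if some (necessarily unique) $i$ with $|u|<i\le|v|$ has $v[i]=i-1$, else $0$. Each node $u$ stores $|u|$, $\mathsf{Re}(u)$, and, if good, a pointer $\mathsf{SL}(u)$ to node $\mathsf{sl}(u)$. Each edge $(u,v)$ stores a flag for whether $|v|-|u|=1$; if $|v|-|u|=1$ or both $u,v$ are good it stores only $\mathrm{str}(u,v)[1]$, otherwise a triple $(i,j,k)$ with $\mathrm{str}(u,v)=\langle T'\rangle_k[i:j]$ where $T'$ is a stored subsequence of $\mathrm{pre}(T)$ (the parts of $\mathrm{pre}(T)$ referenced by such triples). Fast links: for each edge $(u,v)$ with $|v|-|u|>1$ and both $u,v$ good, $\mathsf{FL}(u,v)=\mathsf{SL}^k(u)$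 where $k\ge1$ is the smallest integer such that $|v_k|<|v|-k$ or $\mathsf{Re}(v_k)>0$, with $v_k=\mathsf{child}(\mathsf{SL}^k(u),a)$ for $a=\mathrm{str}(u,v)[1]$.
   Formalization: FL(u,v) as written may not exist (T=xcxdexcxdfxcg$, u=0c, v=0c2d: no child(c,2)); here v_k follows the first letter of str(sl^k(u),sl^k(v)), which is 0 if a refers to u[1], and k also stops once SL^k(u) is bad. Unchanged wherever the definition makes sense. *)

(* Defs.v *)
(* Strings are [seq]s.  Positions are 1-based: the i-th symbol of w is
   [onth w i.-1], for 1 <= i <= size w. *)
From mathcomp Require Import all_boot all_order all_algebra.
Set Implicit Arguments.
Unset Strict Implicit.
Unset Printing Implicit Defensive.
Import Order.TTheory GRing.Theory Num.Theory.

(* [s] with [f i] applied to its i-th symbol, i = 1, 2, ... *)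
Definition imap1 (A B : Type) (f : nat -> A -> B) (s : seq A) : seq B :=
  [seq f p.1 p.2 | p <- zip (iota 1 (size s)) s].

(* w[i:j] *)
Definition sub_string (A : Type) (i j : nat) (w : seq A) : seq A :=
  take (j.+1 - i) (drop i.-1 w).

(* str(u, v), meaningful when u is a prefix of v *)
Definition str (A : Type) (u v : seq A) : seq A := drop (size u) v.

Section Strings.
Variables Sigma Pi : finType.

(* The disjoint union of the two alphabets; [inl] marks constants. *)
Definition pstring : Type := seq (Sigma + Pi)%type.
Definition pvstring : Type := seq (Sigma + nat)%type.

Definition pmatch (w1 w2 : pstring) : Prop :=
  exists f : Sigma + Pi -> Sigma + Pi,
    [/\ bijective f, forall a : Sigma, f (inl a) = inl a & map f w1 = w2].

Definition has_pmatching_substring (T P : pstring) : Prop :=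
  exists2 w : pstring, infix w T & pmatch w P.

Definition ends_with_sentinel (d : Sigma) (T : pstring) : Prop :=
  exists2 T0 : pstring, T = rcons T0 (inl d) & inl d \notin T0.

Definition pre_sym (w : pstring) (i : nat) (x : Sigma + Pi) : Sigma + nat :=
  match x with
  | inl a => inl a
  | inr _ =>
      inr (if x \in take i.-1 w
           then i - \max_(1 <= j < i | onth w j.-1 == Some x) j
           else 0)
  end.

Definition pre (w : pstring) : pvstring := imap1 (pre_sym w) w.

(* <u>_k.  The index k ranges over all integers: when labels are read from a
   compressed text T' (see [triple_of] below), the origin of the node string
   may fall before the first position of T'. *)
Definition ang_sym (k : int) (i : nat) (a : Sigma + nat) : Sigma + nat :=
  match a with
  | inl c => inl c
  | inr n => inr (if (i%:Z - k + 1 <= n%:Z)%R then 0 else n)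
  end.

Definition ang (k : int) (u : pvstring) : pvstring := imap1 (ang_sym k) u.

Definition sl (u : pvstring) : pvstring := ang 1 (behead u).

Section PLST.
Variable T : pstring.

Definition PrevSub (u : pvstring) : Prop :=
  exists2 w : pstring, infix w T & u = pre w.

(* PSTrie(T) has PrevSub(T) as its nodes and [u -> rcons u a] as its edges. *)
Definition trie_leaf (u : pvstring) : Prop :=
  PrevSub u /\ forall a, ~ PrevSub (rcons u a).

Definition trie_branching (u : pvstring) : Prop :=
  PrevSub u /\
  exists a b, [/\ a <> b, PrevSub (rcons u a) & PrevSub (rcons u b)].

Definition type1 (u : pvstring) : Prop :=
  [\/ u = [::], trie_leaf u | trie_branching u].

Definition type2 (u : pvstring) : Prop :=
  [/\ PrevSub u, ~ type1 u & type1 (sl u)].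

Definition plst_node (u : pvstring) : Prop := type1 u \/ type2 u.

Definition plst_edge (u w : pvstring) : Prop :=
  exists v : pvstring,
    [/\ w = u ++ v, plst_node u, plst_node w, v <> [::]
      & forall v', prefix v' v -> v' <> [::] -> v' <> v ->
          ~ plst_node (u ++ v')].

(* v = child(u, a) *)
Definition is_child (u : pvstring) (a : Sigma + nat) (v : pvstring) : Prop :=
  plst_edge u v /\ ohead (str u v) = Some a.

Definition good (u : pvstring) : Prop :=
  [/\ plst_node u, u <> [::] & plst_node (sl u)].

(* Re(v), where u is the parent of v.  The position is unique on edges of
   PLST(T): edges leaving the root have length 1, and a letter i - 1 at a
   position i > 1 refers to the last earlier occurrence of the first symbol. *)
Definition Re (u v : pvstring) : nat :=
  if [seq i <- iota (size u).+1 (size v - size u)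
         | onth v i.-1 == Some (inr i.-1)] is i :: _
  then i - size u else 0.

(* Stopping condition of the fast link of (u, v) at SL^k(u).  Here
   vk = child(SL^k(u), a) where a is the letter that follows SL^k(u) on the
   way to sl^k(v).  This letter is str(u, v)[1], except that if str(u, v)[1]
   refers to the first position of u, which sl deletes, it becomes 0 and
   child(SL^k(u), str(u, v)[1]) would not exist.
   The chain also stops at a bad node, beyond which SL is undefined. *)
Definition fast_link_stop (u v : pvstring) (k : nat) : Prop :=
  (exists a vk,
     [/\ ohead (str (iter k sl u) (iter k sl v)) = Some a,
         is_child (iter k sl u) a vk
       & size vk < size v - k \/ 0 < Re (iter k sl u) vk])
  \/ ~ good (iter k sl u).

(* w = FL(u, v) *)
Definition is_fast_link (u v w : pvstring) : Prop :=
  exists k : nat,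
    [/\ 0 < k, fast_link_stop u v k,
        forall j, 0 < j < k -> ~ fast_link_stop u v j
      & w = iter k sl u].

(* (i, j, k) is a triple for the edge (u, v) with respect to T' *)
Definition triple_of (T' : pvstring) (u v : pvstring) (i j : nat) (k : int) :
    Prop :=
  [/\ 1 <= i, i <= j, j <= size T' & str u v = sub_string i j (ang k T')].

End PLST.

(* Machine codes of symbols: constants are negative, all others are >= 0. *)
Definition code_psym (x : Sigma + Pi) : int :=
  match x with
  | inl a => (- Posz (enum_rank a).+1)%R
  | inr b => Posz (enum_rank b)
  end.

Definition code_pvsym (x : Sigma + nat) : int :=
  match x with
  | inl a => (- Posz (enum_rank a).+1)%R
  | inr n => Posz n
  end.

End Strings.

(* A unit-cost RAM.  Its memory consists of integer registers and integer
   arrays; its only arithmetic operations are addition and subtraction. *)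
Record state := State {
  reg : nat -> int;
  arr : nat -> int -> int
}.

Inductive expr :=
| Cst of int
| Reg of nat
| Get of nat & expr        (* Get a e: the cell of array a at index e *)
| Plus of expr & expr
| Minus of expr & expr.

Inductive test := TEq of expr & expr | TLt of expr & expr.

Inductive cmd :=
| Skip
| SetReg of nat & expr
| Put of nat & expr & expr (* Put a e1 e2: array a, index e1, value e2 *)
| Seq of cmd & cmd
| If of test & cmd & cmd
| While of test & cmd.

Fixpoint eval (s : state) (e : expr) : int :=
  match e with
  | Cst z => z
  | Reg r => reg s r
  | Get a e1 => arr s a (eval s e1)
  | Plus e1 e2 => (eval s e1 + eval s e2)%R
  | Minus e1 e2 => (eval s e1 - eval s e2)%R
  end.

Definition eval_test (s : state) (b : test) : bool :=
  match b with
  | TEq e1 e2 => eval s e1 == eval s e2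
  | TLt e1 e2 => (eval s e1 < eval s e2)%R
  end.

Definition set_reg (s : state) (r : nat) (z : int) : state :=
  State (fun r' => if r' == r then z else reg s r') (arr s).

Definition set_cell (s : state) (a : nat) (i z : int) : state :=
  State (reg s)
        (fun a' i' => if (a' == a) && (i' == i) then z else arr s a' i').

Definition in_word (W : nat) (z : int) : Prop := (`|z| <= W%:Z)%R.

(* [exec W p s t s']: started in s, the program p halts in s' after t steps,
   and every index and value written fits in a machine word, i.e. is bounded
   by W in absolute value (p gets stuck otherwise).  Every assignment and
   every evaluation of a test is one step: the expressions of a fixed program
   have constant size. *)
Inductive exec (W : nat) : cmd -> state -> nat -> state -> Prop :=
| ExecSkip s : exec W Skip s 1 s
| ExecSetReg s r e :
    in_word W (eval s e) ->
    exec W (SetReg r e) s 1 (set_reg s r (eval s e))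
| ExecPut s a e1 e2 :
    in_word W (eval s e1) -> in_word W (eval s e2) ->
    exec W (Put a e1 e2) s 1 (set_cell s a (eval s e1) (eval s e2))
| ExecSeq p1 p2 s s1 s2 t1 t2 :
    exec W p1 s t1 s1 -> exec W p2 s1 t2 s2 ->
    exec W (Seq p1 p2) s (t1 + t2) s2
| ExecIfTrue b p1 p2 s t s1 :
    eval_test s b -> exec W p1 s t s1 -> exec W (If b p1 p2) s t.+1 s1
| ExecIfFalse b p1 p2 s t s1 :
    ~~ eval_test s b -> exec W p2 s t s1 -> exec W (If b p1 p2) s t.+1 s1
| ExecWhileFalse b p s :
    ~~ eval_test s b -> exec W (While b p) s 1 s
| ExecWhileTrue b p s s1 s2 t1 t2 :
    eval_test s b -> exec W p s t1 s1 -> exec W (While b p) s1 t2 s2 ->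
    exec W (While b p) s (t1 + t2).+1 s2.

Definition word_state (W : nat) (s : state) : Prop :=
  (forall r, in_word W (reg s r)) /\ (forall a i, in_word W (arr s a i)).

(* Registers and arrays holding the input and the output. *)
Definition rOut  : nat := 0.  (* answer *)
Definition rRoot : nat := 1.  (* address of the root *)
Definition rLen  : nat := 2.  (* |P| *)

Definition aNodeLen   : nat := 0.   (* |u| *)
Definition aNodeRe    : nat := 1.   (* Re(u) *)
Definition aNodeSL    : nat := 2.   (* SL(u), or -1 if u is bad *)
Definition aNodeEdges : nat := 3.   (* first outgoing edge of u, or -1 *)
Definition aEdgeNext  : nat := 4.   (* next edge with the same source, or -1 *)
Definition aEdgeTo    : nat := 5.   (* target *)
Definition aEdgeUnit  : nat := 6.   (* 1 if the edge has length 1, else 0 *)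
Definition aEdgeSym   : nat := 7.   (* first symbol of the label *)
Definition aEdgeI     : nat := 8.   (* the triple (i, j, k) *)
Definition aEdgeJ     : nat := 9.
Definition aEdgeK     : nat := 10.
Definition aEdgeFL    : nat := 11.  (* fast link *)
Definition aText      : nat := 12.  (* T', from index 1 *)
Definition aPattern   : nat := 13.  (* P, from index 1 *)

Section Storage.
Variables Sigma Pi : finType.

(* In the linked list of edge records starting at x, the targets are vs;
   an edge is identified with its target, [edge_at v] being its address. *)
Fixpoint edge_list (s : state) (edge_at : pvstring Sigma -> int) (x : int)
    (vs : seq (pvstring Sigma)) : Prop :=
  match vs with
  | [::] => x = (-1)%R
  | v :: vs' => x = edge_at v /\ edge_list s edge_at (arr s aEdgeNext x) vs'
  end.

Definition stores_node (T : pstring Sigma Pi) (s : state)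
    (node_at edge_at : pvstring Sigma -> int) (u : pvstring Sigma) : Prop :=
  let x := node_at u in
  [/\ arr s aNodeLen x = Posz (size u),
      forall p, plst_edge T p u -> arr s aNodeRe x = Posz (Re p u),
      good T u -> arr s aNodeSL x = node_at (sl u),
      ~ good T u -> arr s aNodeSL x = (-1)%R
    & exists vs : seq (pvstring Sigma),
        [/\ uniq vs, forall v, v \in vs <-> plst_edge T u v
          & edge_list s edge_at (arr s aNodeEdges x) vs]].

Definition stores_edge (T : pstring Sigma Pi) (s : state)
    (node_at edge_at : pvstring Sigma -> int) (T' : pvstring Sigma)
    (u v : pvstring Sigma) : Prop :=
  let x := edge_at v in
  let unit_edge := size v - size u = 1 in
  let both_good := good T u /\ good T v in
  [/\ arr s aEdgeTo x = node_at v,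
      arr s aEdgeUnit x = Posz (size v - size u == 1),
      unit_edge \/ both_good ->
        exists2 a, ohead (str u v) = Some a & arr s aEdgeSym x = code_pvsym a,
      ~ (unit_edge \/ both_good) ->
        exists i j k,
          [/\ triple_of T' u v i j k, arr s aEdgeI x = Posz i,
              arr s aEdgeJ x = Posz j & arr s aEdgeK x = k]
    & ~ unit_edge -> both_good ->
        exists2 w, is_fast_link T u v w & arr s aEdgeFL x = node_at w].

(* The memory contains PLST(T).  Addresses of records are arbitrary (distinct,
   nonnegative); fields left unspecified and all the remaining memory have
   arbitrary contents.  The text T itself is not stored. *)
Definition stores_PLST (T : pstring Sigma Pi) (s : state) : Prop :=
  exists (node_at edge_at : pvstring Sigma -> int) (T' : pvstring Sigma),
    [/\ forall u, plst_node T u ->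
          (0 <= node_at u)%R /\ stores_node T s node_at edge_at u,
        forall u v, plst_edge T u v ->
          (0 <= edge_at v)%R /\ stores_edge T s node_at edge_at T' u v,
        (forall u v, plst_node T u -> plst_node T v ->
           node_at u = node_at v -> u = v) /\
        (forall u u' v v', plst_edge T u v -> plst_edge T u' v' ->
           edge_at v = edge_at v' -> v = v'),
        subseq T' (pre T) /\
        (forall i a, onth T' i = Some a ->
           arr s aText (Posz i.+1) = code_pvsym a)
      & reg s rRoot = node_at [::]].

Definition stores_pattern (P : pstring Sigma Pi) (s : state) : Prop :=
  reg s rLen = Posz (size P) /\
  forall i x, onth P i = Some x -> arr s aPattern (Posz i.+1) = code_psym x.

End Storage.

(* Main.v *)
(* P p-matches a substring of T iff pre(P) is a node of PSTrie(T), so the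
   program spells pre(P) from the root.  The label of an edge (u, v) that is
   not stored is checked along the path starting at FL(u, v) = sl^k(u); the
   edge is suspended on a stack meanwhile.  The position of P that has been
   reached and a "level" (the total number k of deleted symbols) describe the
   current search.

   Correctness.  The nodes strictly inside the path below FL(u, v) are not of
   type 1, because their preimages one level up are not nodes; so the path is
   forced, and walking it by the symbols of P loses nothing.  A label symbol
   read at a deep level may have become 0 only because it referred to the first
   symbol of some suspended u; such positions are given by Re(v) and recorded in
   an array, so that every symbol read is compared with pre(P) itself.

   Time.  A push is charged to the next comparison, or to a new node strictly
   inside the task, or to the position given by Re, which is 0 at all deeper
   levels, or to a task end q that is not a node at the new level.  In the last
   case the level crossed a node x for which sl(x) is not a node; all children
   of x become 0 in sl(x), so the symbol of P after q is 0 at the new level.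
   At each level at most |Pi| symbols are 0, so there are O(|P|) charges. *)
Require Import Defs.
From mathcomp Require Import all_boot all_order all_algebra.
From mathcomp Require Import perm zify boolp.
Set Implicit Arguments.
Unset Strict Implicit.
Unset Printing Implicit Defensive.

Arguments sl {Sigma} u.

(** At a deep level only a suffix is visible, and [sl] has merged letters, so what is read there
    does not by itself determine the string at level 0. The invariant therefore carries a ghost
    string [Y], which the program never computes: the suspended edge fixes [Y] up to the end of the
    task, and since [Y] lies in the trie, agreement of [pre P] with [Y] gives membership in the
    trie. The obstacle in the time bound is that a push cannot always be paid at once, since the
    comparison that pays for it may come only afterwards. So a push may leave a debt, but only if
    the next edge is compared directly; debts then never accumulate. Charges are counted by a
    potential attached to positions, which can only shrink as the level grows. Its sum up to the end
    of the task, together with the same sums for the suspended tasks, pays for the rest of the run.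
    The structural arguments need prefixes of [pre P] that are in the trie. If [M] is the length of
    the longest one, the two indices [M - 1] and [M] get a free charge at every level, besides those
    of the zeros. *)

Lemma onth_take (A : Type) (s : seq A) n i :
  onth (take n s) i = if i < n then onth s i else None.
Proof.
elim: s n i => [|x s IH] [|n] [|i] //=; first by case: ifP.
by rewrite IH ltnS.
Qed.

Lemma onth_drop (A : Type) (s : seq A) n i : onth (drop n s) i = onth s (n + i).
Proof. by elim: s n => [|x s IH] [|n] //=; rewrite ?onth0n. Qed.

Lemma onth_size (A : Type) (s : seq A) i x : onth s i = Some x -> i < size s.
Proof. by move=> h; rewrite -onthTE h. Qed.

Lemma onth_ex (A : Type) (s : seq A) i : i < size s -> exists x, onth s i = Some x.
Proof. by rewrite -onthTE; case: (onth s i) => // x _; exists x. Qed.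

Lemma onth_rcons (A : Type) (s : seq A) x i :
  onth (rcons s x) i = if i < size s then onth s i
                       else if i == size s then Some x else None.
Proof.
rewrite -cats1 onth_cat; case: ltnP => // h.
case: eqP => [->|/eqP ne]; first by rewrite subnn.
by rewrite onth_default //= subn_gt0 ltn_neqAle eq_sym ne h.
Qed.

Lemma ohead_onth (A : Type) (s : seq A) : ohead s = onth s 0.
Proof. by case: s. Qed.

Lemma take_onthS (A : Type) (s : seq A) i x :
  onth s i = Some x -> take i.+1 s = rcons (take i s) x.
Proof.
move=> h; apply: eq_from_onth => j; have hi := onth_size h.
rewrite onth_rcons !onth_take size_take hi ltnS leq_eqVlt.
by case: eqVneq => [->|] /=; rewrite ?h ?ltnn //; case: ltnP.
Qed.

Lemma eq_take_onth (A : Type) (s t : seq A) n i :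
  take n s = take n t -> i < n -> onth s i = onth t i.
Proof.
by move=> e h; have := congr1 (fun w => onth w i) e; rewrite !onth_take h.
Qed.

Lemma onth_imap1 (A B : Type) (f : nat -> A -> B) (s : seq A) i :
  onth (imap1 f s) i = omap (f i.+1) (onth s i).
Proof.
rewrite /imap1 onth_map.
suff -> m : onth (zip (iota m (size s)) s) i
            = omap (fun x => (m + i, x)) (onth s i) by case: (onth s i).
elim: s i m => [|x s IH] [|i] m //=; first by rewrite addn0.
by rewrite IH addSnnS.
Qed.

Lemma size_imap1 (A B : Type) (f : nat -> A -> B) (s : seq A) :
  size (imap1 f s) = size s.
Proof. by rewrite size_map size_zip size_iota minnn. Qed.

(** * The suffix operation [sl], symbol by symbol *)

Section Zap.
Variable Sigma : finType.
Implicit Types u v : pvstring Sigma.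

(* The symbol at 0-based index i survives [sl] iff its reference stays inside. *)
Definition zap (i : nat) (a : Sigma + nat) : Sigma + nat :=
  if a is inr n then inr (if i < n then 0 else n) else a.

Definition valid u := forall i a, onth u i = Some a -> zap i a = a.

Lemma zap_zap i j a : i <= j -> zap i (zap j a) = zap i a.
Proof.
case: a => //= n h; congr inr; case: (ltnP j n) => // h2.
by rewrite (leq_ltn_trans h h2).
Qed.

Lemma size_sl u : size (sl u) = (size u).-1.
Proof. by rewrite /sl /ang size_imap1 size_behead. Qed.

Lemma size_iter_sl k u : size (iter k sl u) = size u - k.
Proof. by elim: k => [|k IH]; rewrite ?subn0 // iterS size_sl IH subnS. Qed.

Lemma onth_sl u i : onth (sl u) i = omap (zap i) (onth u i.+1).
Proof.
rewrite /sl /ang onth_imap1 -drop1 onth_drop add1n.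
case: (onth u i.+1) => //= [[c|n]] //=; congr (Some (inr _)).
have -> : (i.+1%:Z - 1 + 1 <= n%:Z)%R = (i < n) by lia.
by [].
Qed.

(** The last [zap] has the smallest bound and absorbs the earlier ones, so k deletions act on a
    letter as a single [zap]. Validity covers the case k = 0. *)
Lemma onth_iter_sl k u i :
  valid u -> onth (iter k sl u) i = omap (zap i) (onth u (k + i)).
Proof.
move=> vu; elim: k i => [|k IH] i.
  by rewrite /= add0n; case E: (onth u i) => [a|] //=; rewrite (vu _ _ E).
rewrite iterS onth_sl IH addSnnS.
by case: (onth u _) => //= a; rewrite zap_zap.
Qed.

Lemma valid_take n u : valid u -> valid (take n u).
Proof. by move=> vu i a; rewrite onth_take; case: ifP => // _; apply: vu. Qed.

Lemma take_sl n u : take n (sl u) = sl (take n.+1 u).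
Proof.
by apply: eq_from_onth => i; rewrite onth_sl !onth_take onth_sl ltnS; case: ifP.
Qed.

Lemma iter_sl_take k n u : iter k sl (take n u) = take (n - k) (iter k sl u).
Proof.
elim: k => [|k IH]; first by rewrite subn0.
rewrite !iterS IH; case: (ltnP k n) => h.
  by rewrite take_sl; congr (sl (take _ _)); lia.
have -> : n - k = 0 by lia.
have -> : n - k.+1 = 0 by lia.
by rewrite !take0.
Qed.

Lemma sl_rcons u a : u <> [::] -> sl (rcons u a) = rcons (sl u) (zap (size u).-1 a).
Proof.
move=> nz; apply: eq_from_onth => i.
have sz : 0 < size u by case: (u) nz.
rewrite onth_sl !onth_rcons onth_sl size_sl.
have -> : (i < (size u).-1) = (i.+1 < size u) by lia.
have -> : (i == (size u).-1) = (i.+1 == size u) by lia.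
case: ltnP => //= _; case: eqP => //= e.
by congr (Some (zap _ _)); lia.
Qed.

End Zap.

(** * Prev-encoding and p-matching *)

Section Pre.
Variables Sigma Pi : finType.
Implicit Types (w : pstring Sigma Pi).

(* Last position before i, 1-based, where x occurs in w; 0 if there is none. *)
Definition lastpos w (x : Sigma + Pi) i : nat :=
  \max_(1 <= j < i | onth w j.-1 == Some x) j.

Lemma lastpos0 w x : lastpos w x 1 = 0.
Proof. by rewrite /lastpos big_geq. Qed.

Lemma lastposS w x i :
  lastpos w x i.+2 = if onth w i == Some x then i.+1 else lastpos w x i.+1.
Proof.
rewrite /lastpos big_mkcond big_nat_recr //= -big_mkcond /=.
case: ifP => h; last by rewrite maxn0.
apply/maxn_idPr/bigmax_leqP_seq => j; rewrite mem_index_iota; lia.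
Qed.

Lemma lastposP w x i :
  (lastpos w x i.+1 = 0 /\ forall j, j < i -> onth w j <> Some x) \/
  exists2 j, lastpos w x i.+1 = j.+1 &
    [/\ j < i, onth w j = Some x & forall j', j < j' < i -> onth w j' <> Some x].
Proof.
elim: i => [|i IH]; first by left; rewrite lastpos0.
rewrite lastposS; case: eqP => h.
  by right; exists i => //; split=> // j'; lia.
case: IH => [[e IH]|[j e [h1 h2 h3]]].
  left; split=> // j; rewrite ltnS leq_eqVlt => /orP[/eqP->//|]; exact: IH.
right; exists j => //; split=> // [|j' /andP[hj]]; first by lia.
by rewrite ltnS leq_eqVlt => /orP[/eqP->//|h']; apply: h3; lia.
Qed.

Lemma pre_symE w i (b : Pi) : i <= size w ->
  pre_sym w i.+1 (inr b) =
    inr (let l := lastpos w (inr b) i.+1 in if l == 0 then 0 else i.+1 - l).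
Proof.
move=> hi /=; congr inr; rewrite -/(lastpos w (inr b) i.+1).
case: (lastposP w (inr b) i) => [[-> h]|[j -> [h1 h2 h3]]] /=.
  case: ifP => // /onthP[j]; rewrite onth_take; case: ifP => // /h //.
case: ifP => // /negP[]; apply/onthP; exists j; by rewrite onth_take h1.
Qed.

Lemma size_pre w : size (pre w) = size w.
Proof. exact: size_imap1. Qed.

Lemma onth_pre w i : onth (pre w) i = omap (pre_sym w i.+1) (onth w i).
Proof. exact: onth_imap1. Qed.

Lemma onth_pre_inl w i a : onth (pre w) i = Some (inl a) <-> onth w i = Some (inl a).
Proof.
rewrite onth_pre; case: (onth w i) => [[c|b]|] /=; split=> // -[->]//.
Qed.

Lemma onth_preP w i n : onth (pre w) i = Some (inr n) <->
  exists2 b, onth w i = Some (inr b) &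
    n = 0 /\ (forall j, j < i -> onth w j <> Some (inr b)) \/
    [/\ 0 < n <= i, onth w (i - n) = Some (inr b)
      & forall j, i - n < j < i -> onth w j <> Some (inr b)].
Proof.
rewrite onth_pre; case E: (onth w i) => [[c|b]|] /=; try by split=> // -[].
have hi := onth_size E; have := pre_symE b (ltnW hi); rewrite /= => ->.
case: (lastposP w (inr b) i) => [[-> h]|[j -> [h1 h2 h3]]] /=.
  split=> [[<-]|[_ [<-] []]]; first by exists b => //; left.
    by move=> [-> _].
  by move=> [h4 /h]; lia.
rewrite subSS; split=> [[<-]|[_ [<-] []]].
- exists b => //; right; split; [lia| |move=> j' hj'; apply: h3; lia].
  by have -> : i - (i - j) = j by lia.
- by move=> [_ /(_ j h1)].
move=> [h4 h5 h6]; congr (Some (inr _)).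
case: (ltngtP j (i - n)) => [h|h|]; last by lia.
  by case: (h3 (i - n)) => //; lia.
by case: (h6 j) => //; lia.
Qed.

Lemma valid_pre w : valid (pre w).
Proof.
move=> i [c|n] //= /onth_preP[b _ [[-> //]|[h _ _]]].
by rewrite ltnNge; case/andP: h => _ ->.
Qed.

Lemma pre_take n w : pre (take n w) = take n (pre w).
Proof.
apply: eq_from_onth => i; rewrite onth_take.
case: ltnP => h; last by rewrite onth_default // size_pre size_take_min; lia.
rewrite !onth_pre onth_take h; case: (onth w i) => //= -[//|b] /=.
rewrite take_takel; last by lia.
congr (Some (inr _)); case: ifP => // _; congr subn.
rewrite big_nat_cond [RHS]big_nat_cond; apply: eq_bigl => j.
by rewrite onth_take; case: ifP => //; lia.
Qed.

Lemma pre_behead w : pre (behead w) = sl (pre w).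
Proof.
apply: eq_from_onth => i; rewrite onth_sl.
case E: (onth (pre w) i.+1) => [[c|n]|] /=.
- by move/onth_pre_inl: E => E; apply/onth_pre_inl; rewrite -drop1 onth_drop.
- move/onth_preP: E => [b E H]; apply/onth_preP; exists b; first by rewrite -drop1 onth_drop.
  case: H => [[-> H]|[h1 h2 h3]]; first by left; split=> // j hj; rewrite -drop1 onth_drop; apply: H.
  case: ltnP => h; [left|right]; split=> //.
  + by move=> j hj; rewrite -drop1 onth_drop; apply: h3; lia.
  + by lia.
  + by rewrite -drop1 onth_drop -h2; congr onth; lia.
  + by move=> j hj; rewrite -drop1 onth_drop; apply: h3; lia.
rewrite onth_default // size_pre size_behead.
have : size w <= i.+1 by rewrite -size_pre leqNgt -onthTE E.
by case: (size w).
Qed.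

(** A reference goes to the latest earlier occurrence. If two symbols shared their target, the later
    one would have to refer to the earlier one instead. *)
Lemma pre_ref_inj w i j n n' : onth (pre w) i = Some (inr n) ->
  onth (pre w) j = Some (inr n') -> 0 < n -> 0 < n' -> i - n = j - n' -> i = j.
Proof.
move=> /onth_preP[b E1 [[-> //]|[h1 h2 h3]]] /onth_preP[b' E2 [[-> //]|[h4 h5 h6]]] _ _ e.
have eb : Some (inr b) = Some (inr b') :> option (Sigma + Pi) by rewrite -h2 e.
case: (ltngtP i j) => // h.
  by case: (h6 i); [lia|rewrite E1].
by case: (h3 j); [lia|rewrite E2].
Qed.

(** A parameter is encoded by 0 at its first occurrence only, so the zeros of a prefix count its
    distinct parameters. *)
Lemma pre_zeros w : count_mem (inr 0) (pre w) <= #|Pi|.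
Proof.
have H n : n <= size w ->
  count_mem (inr 0) (take n (pre w)) = #|[set b | inr b \in take n w]|.
  elim: n => [|n IH] hn.
    rewrite !take0; apply/esym/eqP; rewrite cards_eq0; apply/eqP/setP => b.
    by rewrite !inE in_nil.
  have [x Ex] := onth_ex hn.
  have hx : onth (pre w) n = Some (pre_sym w n.+1 x) by rewrite onth_pre Ex.
  rewrite (take_onthS Ex) (take_onthS hx) -cats1 count_cat IH ?(ltnW hn) //= addn0.
  case: x Ex hx => [c|b] Ex hx /=.
    rewrite addn0; apply: eq_card => b; rewrite !inE mem_rcons in_cons.
    by case: (inr b \in _).
  have -> : [set b0 | inr b0 \in rcons (take n w) (inr b)]
            = b |: [set b0 | inr b0 \in take n w].
    by apply/setP => b0; rewrite !inE mem_rcons in_cons.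
  rewrite cardsU1 inE addnC; congr addn.
  case: ifP => hb /=; last by [].
  have := pre_symE b (ltnW hn); rewrite /= hb => -[] ->.
  case: (lastposP w (inr b) n) => [[_ h]|[j -> [h1 h2 h3]]] /=; last first.
    rewrite eqE /= eqE /=; lia.
  by move/onthP: hb => [j]; rewrite onth_take; case: ifP => // /h.
rewrite -(take_oversize (leqnn (size (pre w)))) size_pre H // max_card //.
Qed.

(** A bijection transports occurrences, which gives one direction. For the other, the bijection is
    built one symbol at a time, and only a parameter that is new on both sides forces a change. *)
Lemma pmatch_pre w1 w2 : pmatch w1 w2 <-> pre w1 = pre w2.
Proof.
split=> [[f [fb fc fw]]|].
  have fi := bij_inj fb.
  have fP b : exists b', f (inr b) = inr b'.
    case E: (f (inr b)) => [c|b']; last by exists b'.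
    by have := fi _ _ (etrans E (esym (fc c))).
  have fo j x : onth w2 j = Some (f x) <-> onth w1 j = Some x.
    rewrite -fw onth_map; case: (onth w1 j) => //= y.
    by split=> [[/fi->]|[->]].
  apply: eq_from_onth => i; case E: (onth (pre w1) i) => [[c|n]|].
  - by apply/esym/onth_pre_inl; rewrite -(fc c); apply/fo/onth_pre_inl.
  - move/onth_preP: E => [b E H]; have [b' eb] := fP b.
    apply/esym/onth_preP; exists b'; first by rewrite -eb; apply/fo.
    case: H => [[-> H]|[h1 h2 h3]]; [left|right]; split=> //.
    + by move=> j hj; rewrite -eb; move/fo; apply: H.
    + by rewrite -eb; apply/fo.
    + by move=> j hj; rewrite -eb; move/fo; apply: h3.
  - rewrite onth_default // size_pre -fw size_map -(size_pre w1) leqNgt -onthTE.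
    by rewrite E.
elim/last_ind: w1 w2 => [|w1 x IH] w2 e.
  have := congr1 size e; rewrite !size_pre => /esym/size0nil ->.
  by exists id; split=> //; exists id.
have := congr1 size e; rewrite !size_pre size_rcons.
case/lastP: w2 e => [//|w2 y] e; rewrite size_rcons => -[sz].
have e' : pre w1 = pre w2.
  have := congr1 (take (size w1)) e.
  by rewrite -!pre_take {2}sz -!cats1 !take_size_cat.
have [f [fb fc fw]] := IH _ e'; have fi := bij_inj fb.
have Ex : onth (rcons w1 x) (size w1) = Some x by rewrite onth_rcons ltnn eqxx.
have Ey : onth (rcons w2 y) (size w1) = Some y by rewrite onth_rcons sz ltnn eqxx.
have Ei := congr1 (fun s => onth s (size w1)) e.
case: x e Ex Ei => [c|b] e Ex Ei.
  have := Ei; move/onth_pre_inl: (Ex) => ->.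
  move=> /esym/onth_pre_inl; rewrite Ey => -[->].
  by exists f; split=> //; rewrite map_rcons fw fc.
case E: (onth (pre (rcons w1 (inr b))) (size w1)) => [[c|n]|].
- by move/onth_pre_inl: E; rewrite Ex.
- move: Ei; rewrite E => /esym Ei.
  move/onth_preP: E => [b0 Eb H]; rewrite Ex in Eb; case: Eb => eb; subst b0.
  move/onth_preP: Ei => [b' Eb' H']; rewrite Ey in Eb'; case: Eb' => ey; subst y.
  case: H => [[n0 H]|[h1 h2 h3]]; last first.
    case: H' => [[n0]|[h4 h5 h6]]; first by lia.
    exists f; split=> //; rewrite map_rcons fw; congr rcons.
    move: h2 h5; rewrite !onth_rcons -sz.
    have -> : size w1 - n < size w1 by lia.
    by move=> h2 h5; move: h5; rewrite -fw onth_map h2 => -[].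
  case: H' => [[_ H']|[]]; last by lia.
  have xw1 : inr b \notin w1.
    apply/onthP => -[j hj]; have hs := onth_size hj.
    by apply: (H j) => //; rewrite onth_rcons hs.
  have yw2 : inr b' \notin w2.
    apply/onthP => -[j hj]; have hs := onth_size hj.
    by apply: (H' j); rewrite ?sz // onth_rcons hs.
  have fP : exists b1, f (inr b) = inr b1.
    case E: (f (inr b)) => [c|b1]; last by exists b1.
    by have := fi _ _ (etrans E (esym (fc c))).
  case: fP => b1 eb1.
  (* Neither transposed symbol is the image of an earlier symbol, since [inr b] is new in the first
     word and [inr b'] in the second; so the earlier images stay. *)
  exists (tperm (inr b1) (inr b') \o f); split.
  - by apply: bij_comp => //; exact: (inv_bij (@tpermK _ _ _)).
  - by move=> a; rewrite /= fc tpermD.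
  rewrite map_rcons /= eb1 tpermL; congr rcons.
  rewrite -fw; apply/eq_in_map => z hz /=; rewrite tpermD //.
    by rewrite -eb1; apply/eqP => /fi ez; rewrite ez hz in xw1.
  by apply/eqP => ez; move: yw2; rewrite ez -fw map_f.
by have := @onth_ex _ (pre (rcons w1 (inr b))) (size w1); rewrite E size_pre size_rcons => /(_ (leqnn _)) [].
Qed.

End Pre.

(** * The trie and its fast links *)

Section Trie.
Variables (Sigma Pi : finType) (T : pstring Sigma Pi).
Implicit Types (u v x y : pvstring Sigma) (a b : Sigma + nat).

Local Notation PS := (@PrevSub Sigma Pi T).
Local Notation node := (@plst_node Sigma Pi T).
Local Notation edge := (@plst_edge Sigma Pi T).

Lemma iter_sl_rcons k u a : valid (rcons u a) -> k <= size u ->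
  iter k sl (rcons u a) = rcons (iter k sl u) (zap (size u - k) a).
Proof.
move=> va hk; have vu : valid u.
  by rewrite -(take_size_cat (s1 := u) [:: a] erefl) cats1; apply: valid_take.
apply: eq_from_onth => i; rewrite onth_iter_sl // !onth_rcons onth_iter_sl // size_iter_sl.
have -> : (i < size u - k) = (k + i < size u) by lia.
have -> : (i == size u - k) = (k + i == size u) by lia.
case: ltnP => // _; case: eqP => //= e.
by congr (Some (zap _ _)); lia.
Qed.

Lemma PrevSub_take n u : PS u -> PS (take n u).
Proof.
move=> [w wT ->]; exists (take n w); last by rewrite pre_take.
exact: infix_trans (infix_take _ _) wT.
Qed.

Lemma PrevSub_sl u : PS u -> PS (sl u).
Proof.
move=> [w wT ->]; exists (behead w); last by rewrite pre_behead.
rewrite -drop1; exact: infix_trans (infix_drop _ _) wT.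
Qed.

Lemma PrevSub_iter_sl k u : PS u -> PS (iter k sl u).
Proof. by move=> h; elim: k => //= k; apply: PrevSub_sl. Qed.

Lemma PrevSub_valid u : PS u -> valid u.
Proof. by move=> [w _ ->]; apply: valid_pre. Qed.

Lemma PrevSub_size u : PS u -> size u <= size T.
Proof. by move=> [w wT ->]; rewrite size_pre size_infix. Qed.

Lemma PrevSub_ref_inj u i j n n' : PS u -> onth u i = Some (inr n) ->
  onth u j = Some (inr n') -> 0 < n -> 0 < n' -> i - n = j - n' -> i = j.
Proof. by move=> [w _ ->]; apply: pre_ref_inj. Qed.

Lemma PrevSub_nil : PS [::].
Proof. by exists [::] => //; apply: infix0s. Qed.

Lemma has_pmatching_PrevSub P : has_pmatching_substring T P <-> PS (pre P).
Proof.
by split=> -[w wT]; [move/pmatch_pre|move/esym/pmatch_pre] => e; exists w.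
Qed.

(** Fix [w] with [pre w = u]. A p-matching bijection carries the word behind any child to [w]
    followed by one symbol, so there are no more children than symbols. This makes a linear search
    through an edge list a constant cost. *)
Lemma PrevSub_children u (s : seq (Sigma + nat)) : uniq s ->
  (forall a, a \in s -> PS (rcons u a)) -> size s <= #|{: Sigma + Pi}|.
Proof.
move=> us hs; case: s us hs => [//|a0 s] us hs.
have [w0 _ e0] := hs a0 (mem_head _ _).
have := congr1 size e0; rewrite size_rcons size_pre => sz0.
pose w := take (size u) w0.
have eu : u = pre w by rewrite pre_take -e0 -cats1 take_size_cat.
have sw : size w = size u by rewrite -(size_pre w) -eu.
pose g c := odflt a0 (onth (pre (rcons w c)) (size u)).
rewrite -(size_codom g); apply: uniq_leq_size us _ => a ha.
have [w1 _ e1] := hs a ha.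
have sz1 : size w1 = (size u).+1 by rewrite -size_pre -e1 size_rcons.
have [c hc] := @onth_ex _ w1 (size u) ltac:(lia).
have ew1 : w1 = rcons (take (size u) w1) c.
  by rewrite -(take_onthS hc) take_oversize // sz1.
have e2 : pre (take (size u) w1) = pre w.
  by rewrite pre_take -e1 -cats1 take_size_cat.
have [f [fb fc fw]] := (pmatch_pre _ _).2 e2.
have e3 : pre (rcons w (f c)) = rcons u a.
  rewrite e1; apply/esym/pmatch_pre; exists f; split=> //.
  by rewrite ew1 map_rcons fw.
apply/codomP; exists (f c).
by rewrite /g e3 onth_rcons ltnn eqxx.
Qed.

Lemma node_PrevSub u : node u -> PS u.
Proof. by case=> [[->|[]|[]]|[]] //; apply: PrevSub_nil. Qed.

Lemma node_nil : node [::].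
Proof. by left; constructor. Qed.

(** This is what Type 2 nodes are for: absence of nodes at one level becomes absence of branching at
    the next. *)
Lemma nonnode_sl u : PS u -> ~ node u -> ~ type1 T (sl u).
Proof.
by move=> pu nu t1; apply: nu; case: (EM (type1 T u)); [left|right; split].
Qed.

Lemma type1_uniq_child u a b : ~ type1 T u -> PS u ->
  PS (rcons u a) -> PS (rcons u b) -> a = b.
Proof.
move=> nt pu pa pb; apply: contrapT => ne; apply: nt; apply: Or33; split=> //.
by exists a, b.
Qed.

(** Two paths of the trie can part only at a branching string, and the prefixes in question are not
    of Type 1. *)
Lemma nonbranching_prefix x y i j : PS x -> PS y -> i <= j -> j <= size x ->
  j <= size y -> take i x = take i y ->
  (forall l, i <= l < j -> ~ type1 T (take l x)) -> take j x = take j y.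
Proof.
move=> px py ij jx jy e; elim: j ij jx jy => [|j IH] ij jx jy h.
  by rewrite !take0.
case: (ltngtP i j.+1) ij => // [lt _|<- //].
have ej : take j x = take j y by apply: IH; try lia; move=> l hl; apply: h; lia.
have [a ha] := onth_ex jx; have [b hb] := onth_ex jy.
rewrite (take_onthS ha) (take_onthS hb) ej; congr rcons.
apply: (@type1_uniq_child (take j x)).
- by apply: h; lia.
- exact: PrevSub_take.
- by rewrite -(take_onthS ha); apply: PrevSub_take.
- by rewrite ej -(take_onthS hb); apply: PrevSub_take.
Qed.

Lemma edge_take u v : edge u v <->
  [/\ node u, node v, take (size u) v = u, size u < size v
    & forall i, size u < i < size v -> ~ node (take i v)].
Proof.
split.
  move=> [w [-> nu nv wn h]]; have sw : 0 < size w by case: (w) wn.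
  rewrite size_cat take_size_cat //; split=> //; first by lia.
  move=> i hi; rewrite take_cat ifF; last by lia.
  apply: h; first by apply/prefixP; exists (drop (i - size u) w); rewrite cat_take_drop.
    by move/(congr1 size); rewrite /= size_take_min; lia.
  by move/(congr1 size); rewrite /= size_take_min; lia.
move=> [nu nv e lt h]; exists (drop (size u) v); split=> //.
- by rewrite -{1}e cat_take_drop.
- by move/(congr1 size); rewrite size_drop /=; lia.
move=> v' /prefixP[z ez] v'n v'd.
have sv : size v' + size z = size v - size u by rewrite -size_cat -ez size_drop.
have ev : v = u ++ v' ++ z by rewrite -ez -{1}e cat_take_drop.
have s0 : 0 < size v' by case: (v') v'n.
have s1 : 0 < size z.
  by case: (z) ez => // /esym ez; rewrite cats0 in ez; case: v'd.
have := h (size u + size v'); rewrite {2}ev catA take_size_cat ?size_cat //.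
by apply; lia.
Qed.

Lemma edge_PrevSub u v : edge u v -> PS u /\ PS v.
Proof. by case/edge_take => /node_PrevSub pu /node_PrevSub pv _ _ _. Qed.

Lemma edge_prefix u v y : edge u v -> PS y -> size u < size y <= size v ->
  take (size u).+1 y = take (size u).+1 v -> y = take (size y) v.
Proof.
move=> /edge_take[nu nv e lt h] py hy ey.
rewrite -{1}(take_size y).
apply/esym/(nonbranching_prefix (i := (size u).+1)) => //; try lia.
  exact: node_PrevSub.
by move=> l hl t1; apply: (h l); [lia|left].
Qed.

Lemma child_onth u v a : edge u v -> ohead (str u v) = Some a <-> onth v (size u) = Some a.
Proof. by move=> _; rewrite ohead_onth /str onth_drop addn0. Qed.

Lemma child_take u v a : edge u v -> onth v (size u) = Some a ->
  take (size u).+1 v = rcons u a.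
Proof. by move=> /edge_take[_ _ e _ _] h; rewrite (take_onthS h) e. Qed.

Lemma edge_child_uniq u v v' a : edge u v -> edge u v' ->
  onth v (size u) = Some a -> onth v' (size u) = Some a -> v = v'.
Proof.
wlog le : v v' / size v <= size v' => [hw|].
  move=> e e' h h'; case: (leqP (size v) (size v')) => hs; first exact: hw.
  by apply/esym; apply: hw; rewrite // ltnW.
move=> e e' h h'; have [_ pv] := edge_PrevSub e.
have [_ nv _ lt _] := (edge_take _ _).1 e.
have ev : v = take (size v) v'.
  by apply: (edge_prefix e') => //; rewrite ?lt // (child_take e h) (child_take e' h').
case: (ltngtP (size v) (size v')) le => // [lt' _|es _].
  have [_ _ _ _ hn] := (edge_take _ _).1 e'.
  by case: (hn (size v)); rewrite ?lt // -ev.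
by rewrite ev es take_size.
Qed.

(** A string of the trie that is not a node is not a leaf, so it can be extended until a node
    appears; the size of [T] bounds the extension. *)
Lemma next_node y : PS y -> exists v, [/\ node v, take (size y) v = y, size y <= size v
  & forall i, size y <= i < size v -> ~ node (take i v)].
Proof.
have [n] := ubnP (size T - size y); elim: n y => // n IH y hn py.
case: (EM (node y)) => ny.
  by exists y; rewrite take_size leqnn; split=> // i; lia.
have [a pa] : exists a, PS (rcons y a).
  apply: contrapT => h; apply: ny; left; apply: Or32; split=> // a pa.
  by apply: h; exists a.
have := PrevSub_size pa; rewrite size_rcons => sz.
have [|v [nv ev lv hv]] := IH (rcons y a) _ pa; first by rewrite size_rcons; lia.
rewrite size_rcons in ev lv hv.
have ey : take (size y) v = y.
  by rewrite -(take_takel v (leqnSn _)) ev -cats1 take_size_cat.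
exists v; split=> //; first by lia.
move=> i; case: (eqVneq i (size y)) => [->|ne] hi; first by rewrite ey.
by apply: hv; lia.
Qed.

Lemma child_exists u a : node u -> PS (rcons u a) ->
  exists2 v, edge u v & onth v (size u) = Some a.
Proof.
move=> nu pa; have [v [nv ev lv hv]] := next_node pa.
rewrite size_rcons in ev lv hv.
exists v; last first.
  by rewrite -(eq_take_onth (s := rcons u a) (n := (size u).+1)) ?onth_rcons ?ltnn ?eqxx // -ev take_takel.
apply/edge_take; split=> //.
by rewrite -(take_takel v (leqnSn _)) ev -cats1 take_size_cat.
Qed.

(* A nonroot node whose suffix is not a node is branching, and all its children
   become one child of the suffix: their last symbols are turned into 0. *)
Lemma bad_suffix_zero k y a : node y -> PS (rcons y a) -> k <= size y ->
  ~ node (iter k sl y) -> zap (size y - k) a = inr 0.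
Proof.
move=> ny pa; have va := PrevSub_valid pa.
elim: k => [//|k IH] hk nn.
case: (EM (node (iter k sl y))) => nx; last first.
  by rewrite -(zap_zap (j := size y - k)) ?IH //; lia.
set x := iter k sl y in nn nx.
have px := node_PrevSub nx; have sx : size x = size y - k by rewrite size_iter_sl.
have xn : x <> [::] by move/(congr1 size); rewrite sx /=; lia.
have pxa : PS (rcons x (zap (size y - k) a)).
  by rewrite -iter_sl_rcons //; [apply: PrevSub_iter_sl|lia].
have key b c : PS (rcons x b) -> PS (rcons x c) ->
    zap (size x).-1 b = zap (size x).-1 c.
  move=> pb pc; apply: contrapT => ne; apply: nn; left; apply: Or33.
  split; first exact: PrevSub_sl.
  by exists (zap (size x).-1 b), (zap (size x).-1 c); split=> //; rewrite -sl_rcons //; apply: PrevSub_sl.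
case: nx => [[//|[_ h]|[_ [b [c [bc pb pc]]]]]|[_ _ t1]].
- by case: (h _ pxa).
- have := key _ _ pb pxa; have := key _ _ pb pc.
  rewrite zap_zap; last by lia.
  have -> : size y - k.+1 = (size x).-1 by lia.
  (* [zap] changes a letter only into 0, so the common image of two distinct letters is 0. *)
  case: b c bc {pb pc} => [b|b] [c|c] bc //=; try by move=> [e]; case: bc; rewrite e.
  case: ltnP => hb; case: ltnP => hc.
  + by move=> _ <-.
  + by move=> _ <-.
  + by move=> [->] <-.
  + by move=> [e]; case: bc; rewrite e.
- by case: nn; left.
Qed.

(* Positions count from 0 here: a letter i at index i refers to the first symbol. *)
Lemma ReP u v : edge u v -> u <> [::] ->
  (Re u v = 0 /\ forall i, size u <= i < size v -> onth v i <> Some (inr i)) \/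
  exists i, [/\ size u <= i < size v, onth v i = Some (inr i) & Re u v = i.+1 - size u].
Proof.
move=> e un; have [pu pv] := edge_PrevSub e; have [_ _ _ lt _] := (edge_take _ _).1 e.
rewrite /Re; set s := [seq i <- _ | _].
have ms i : (i \in s) = [&& onth v i.-1 == Some (inr i.-1) & size u < i <= size v].
  by rewrite mem_filter mem_iota; congr andb; lia.
case: s ms => [|i s] ms.
  left; split=> // i hi h; have := ms i.+1.
  by rewrite /= h eqxx in_nil; lia.
have := ms i; rewrite mem_head => /esym/andP[/eqP h1 h2].
by right; exists i.-1; split=> //; lia.
Qed.

Lemma Re_uniq u v i : edge u v -> u <> [::] -> size u <= i < size v ->
  onth v i = Some (inr i) -> Re u v = i.+1 - size u.
Proof.
move=> e un hi h; have [pu pv] := edge_PrevSub e.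
have su : 0 < size u by case: (u) un.
case: (ReP e un) => [[_ /(_ i hi)]//|[j [hj h' ->]]].
by rewrite (PrevSub_ref_inj pv h h') //; lia.
Qed.

(** * What holds at the levels skipped by a fast link *)

Section FastLink.
Variables (u v w : pvstring Sigma).
Hypotheses (euv : edge u v) (gu : good T u) (gv : good T v).

(** By [fl_refs], the only nonzero letter of the label that can lose its reference on the way to
    level [k] is one that refers to the first symbol of [u]; hence the single number [Re] records
    everything the link erases. [fl_inner] stops below level [k], where nodes of Type 2 may lie
    inside the path. *)
Record fast_link_spec k : Prop := FastLinkSpec {
  fl_gt0 : 0 < k;
  fl_le : k <= size u;
  fl_target : w = iter k sl u;
  fl_node : node w;
  fl_inner : forall i j, size u < i < size v -> j < k ->
    ~ node (iter j sl (take i v));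
  fl_refs : forall i n, size u <= i < size v -> onth v i = Some (inr n) ->
    0 < n -> i - n < k -> n = i;
  fl_stop : fast_link_stop T u v k
}.

(** Induction on the level, in [main]. If the inner strings are not nodes at level j, they are not
    of Type 1 at level j + 1, so the path is forced there. As the link does not stop at that level,
    one edge covers the whole path, and its interior is again free of nodes. *)
Lemma fast_linkP : is_fast_link T u v w -> exists k, fast_link_spec k.
Proof.
move=> [k [k0 st nst ew]].
have [pu pv] := edge_PrevSub euv; have [_ _ euv' lt hin] := (edge_take _ _).1 euv.
have gj j : j < k -> good T (iter j sl u).
  case: j => [//|j] hj; apply: contrapT => h; apply: (nst j.+1); first by lia.
  by right.
have ku : k <= size u.
  have [_ h _] := gj k.-1 ltac:(lia).
  have : 0 < size (iter k.-1 sl u) by case: (iter _ _ _) h.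
  by rewrite size_iter_sl; lia.
have nj j : j <= k -> node (iter j sl u).
  case: j => [|j] hj; first by case: gu.
  by have [_ _ h] := gj j hj.
have main j : j < k ->
  (forall i, size u < i < size v -> ~ node (iter j sl (take i v))) /\
  (0 < j -> exists vj, [/\ edge (iter j sl u) vj,
     iter j sl v = take (size v - j) vj & Re (iter j sl u) vj = 0]).
  elim: j => [|j IH] hj; first by split=> // i hi; apply: hin.
  have {IH}[IH _] := IH (ltnW hj).
  have pj : PS (iter j.+1 sl v) by apply: PrevSub_iter_sl.
  have sj : size (iter j.+1 sl v) = size v - j.+1 by rewrite size_iter_sl.
  have su : size (iter j.+1 sl u) = size u - j.+1 by rewrite size_iter_sl.
  have tu : take (size u - j.+1) (iter j.+1 sl v) = iter j.+1 sl u.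
    by rewrite -iter_sl_take euv'.
  have [a ha] := @onth_ex _ (iter j.+1 sl v) (size u - j.+1) ltac:(rewrite sj; lia).
  have [|vj ej hvj] := @child_exists (iter j.+1 sl u) a (nj _ (ltnW hj)).
    by rewrite -tu -(take_onthS ha); apply: PrevSub_take.
  have nstop := nst j.+1 ltac:(lia).
  have lev : size v - j.+1 <= size vj.
    rewrite leqNgt; apply/negP => hlt; apply: nstop; left; exists a, vj.
    split; last by left.
      by rewrite ohead_onth /str onth_drop addn0 su.
    by split=> //; apply/(child_onth _ ej).
  have re0 : Re (iter j.+1 sl u) vj = 0.
    apply/eqP; rewrite -leqn0 leqNgt; apply/negP => hgt; apply: nstop; left; exists a, vj.
    split; last by right.
      by rewrite ohead_onth /str onth_drop addn0 su.
    by split=> //; apply/(child_onth _ ej).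
  have [_ pvj] := edge_PrevSub ej.
  rewrite su in hvj.
  have inner i : size u < i < size v -> ~ type1 T (iter j.+1 sl (take i v)).
    move=> hi; rewrite iterS; apply: nonnode_sl; last exact: IH.
    by apply: PrevSub_iter_sl; apply: PrevSub_take.
  have ev : iter j.+1 sl v = take (size v - j.+1) vj.
    rewrite -{1}(take_size (iter j.+1 sl v)) sj.
    apply: (nonbranching_prefix (i := (size u - j.+1).+1)) => //; try lia.
      rewrite (take_onthS ha) (take_onthS hvj) tu; congr rcons.
      by have [_ _ + _ _] := (edge_take _ _).1 ej; rewrite su.
    move=> l hl; have := inner (l + j.+1) ltac:(lia).
    by rewrite iter_sl_take addnK.
  split; last by move=> _; exists vj.
  move=> i hi; rewrite iter_sl_take ev take_takel; last by lia.
  have [_ _ _ _ h] := (edge_take _ _).1 ej; apply: h; rewrite su; lia.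
exists k; split=> //; first by rewrite ew; apply: nj.
  by move=> i j hi hj; apply: (main j hj).1.
move=> i n hi hn n0 hk.
have vn : n <= i by have := PrevSub_valid pv hn; rewrite /= leqNgt; case: ltnP => // _ []; lia.
(* A letter referring to an index [i - n] strictly between 0 and [k] would refer to the first symbol
   at level [i - n], where [Re] is 0. *)
case: (posnP (i - n)) => [|tpos]; first by lia.
have [_ /(_ tpos)[vj [ej ev re0]]] := main (i - n) hk.
have hj : onth vj n = Some (inr n).
  have := onth_iter_sl (i - n) n (PrevSub_valid pv).
  rewrite ev onth_take; have -> : i - n + n = i by lia.
  rewrite hn /= ltnn; case: ifP => //; lia.
have szj := size_iter_sl (i - n) u; have := onth_size hj => hjs.
have un : iter (i - n) sl u <> [::].
  by have [] := gj _ hk.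
have := Re_uniq ej un _ hj; rewrite re0 szj => H.
have : 0 = n.+1 - (size u - (i - n)) by apply: H; lia.
lia.
Qed.

End FastLink.
End Trie.

(** * Following the pattern through nested edges *)

Section Match.
Variables (Sigma Pi : finType) (T : pstring Sigma Pi) (X : pvstring Sigma).
Hypothesis vX : valid X.
Implicit Types (u v w Y : pvstring Sigma) (mk : nat -> nat) (s p q k : nat).

Local Notation PS := (@PrevSub Sigma Pi T).
Local Notation node := (@plst_node Sigma Pi T).
Local Notation edge := (@plst_edge Sigma Pi T).
Local Notation m := (size X).

Definition ok i := PS (take i X).

(** Positions of the pattern are kept at all levels: index [i] of [X] is index [i - s] at level
    [s]. *)
Definition level s i : pvstring Sigma := iter s sl (take i X).

Lemma size_lev s i : i <= m -> size (level s i) = i - s.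
Proof. by move=> h; rewrite size_iter_sl size_takel. Qed.

Lemma ok_le i j : i <= j -> ok j -> ok i.
Proof. by move=> h oj; rewrite /ok -(take_takel X h); apply: PrevSub_take. Qed.

(* Y is the string spelled by the trie at level 0 along the path under
   consideration, known up to length q; the entries of [mk] recover those of
   its symbols that became 0 at level s. *)
Record deep_ctx mk s p0 q p Y : Prop := DeepCtx {
  dc_gt0 : 0 < s;
  dc_lt : p0 < q;
  dc_size : size Y = q;
  dc_PS : PS Y;
  dc_uniq : forall i, p0 <= i <= q -> ok i -> take i X = take i Y;
  dc_inner : forall i j, p0 < i < q -> j < s -> ~ node (iter j sl (take i Y));
  dc_first : iter s sl (take p0.+1 Y) = level s p0.+1;
  dc_mk : forall i n, p <= i < q -> onth Y i = Some (inr n) ->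
    zap (i - s) (inr n : Sigma + nat) = inr 0 -> mk i = n;
  dc_end : ok q -> q = m \/ exists2 j, j < s & node (level j q)
}.

(** The Boolean tells whether some task is suspended. At the bottom the path is not constrained in
    advance, the task ends with the pattern, and a 0 that is read stands for itself, whence the zero
    marks. *)
Definition ctx (deep : bool) mk s p0 q p : Prop :=
  if deep then exists Y, deep_ctx mk s p0 q p Y
  else [/\ s = 0, q = m & forall i, p <= i < m -> mk i = 0].

Lemma ctx_mono deep mk mk' s p0 q p p' : ctx deep mk s p0 q p -> p <= p' ->
  (forall i, p' <= i -> mk' i = mk i) -> ctx deep mk' s p0 q p'.
Proof.
case: deep => [[Y [h1 h2 h3 h4 h5 h6 h7 h8 h9]]|[h1 h2 h3]] hp hm.
  exists Y; split=> // i n hi hY hz; rewrite hm; last by lia.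
  by apply: h8 hY hz; lia.
by split=> // i hi; rewrite hm ?h3 //; lia.
Qed.

(** The common form of both contexts once the edge to [v] is chosen: from here on there is a single
    candidate [Y] even at level 0. [sel_end] admits level [s] itself, where the edge may end at
    [q]. *)
Record sel mk s p q v Y : Prop := Sel {
  sel_lt : p < q;
  sel_size : size Y = q;
  sel_PS : PS Y;
  sel_uniq : forall i, p <= i <= q -> ok i -> take i X = take i Y;
  sel_path : iter s sl Y = take (q - s) v;
  sel_inner : forall i j, p < i < q -> j < s -> ~ node (iter j sl (take i Y));
  sel_mk : forall i n, p <= i < q -> onth Y i = Some (inr n) ->
    zap (i - s) (inr n : Sigma + nat) = inr 0 -> mk i = n;
  sel_end : ok q -> q = m \/ exists2 j, j <= s & node (level j q)
}.

Lemma lev_rcons s p : s <= p -> p < m -> 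
  exists a, [/\ onth (iter s sl X) (p - s) = Some a & level s p.+1 = rcons (level s p) a].
Proof.
move=> sp pm; have [|a ha] := @onth_ex _ (iter s sl X) (p - s).
  by rewrite size_iter_sl; lia.
exists a; split=> //; rewrite /level !iter_sl_take subSn //.
exact: take_onthS.
Qed.

(** * Choosing an edge determines the path *)

Section Select.
Variables (mk : nat -> nat) (deep : bool) (s p0 qt p : nat) (v : pvstring Sigma).
Let q := minn qt (size v + s).
Hypotheses (hc : ctx deep mk s p0 qt p) (hsp : s <= p0 <= p) (hpq : p < qt <= m).
Hypotheses (okp : ok p) (he : edge (level s p) v)
  (hv : onth v (p - s) = onth (iter s sl X) (p - s)).

Let edge_len : p - s < size v.
Proof.
have [_ _ _ + _] := (edge_take _ _ _).1 he.
by rewrite size_lev //; lia.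
Qed.

Let child_lev : take (p - s).+1 v = level s p.+1.
Proof.
have [a [ha ->]] := @lev_rcons s p ltac:(lia) ltac:(lia).
rewrite -(size_lev s (i := p)); last by lia.
by apply: (child_take he); rewrite size_lev; [rewrite hv|lia].
Qed.

(** At a deep level [Y] is inherited and must be shown to follow the edge to [v]; at level 0 it is a
    prefix of [v]. *)
Lemma select : exists Y, sel mk s p q v Y.
Proof.
have [pu pv] := edge_PrevSub he; have hsz := @size_lev s p ltac:(lia).
have [_ nv _ _ _] := (edge_take _ _ _).1 he.
have vv := PrevSub_valid pv.
case: deep hc => [[Y [h1 h2 h3 h4 h5 h6 h7 h8 h9]]|[h1 h2 h3]].
- have ePath : iter s sl (take q Y) = take (q - s) v.
    have pY : PS (iter s sl (take q Y)) by apply/PrevSub_iter_sl/PrevSub_take.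
    have sY : size (iter s sl (take q Y)) = q - s.
      by rewrite size_iter_sl size_takel // h3 geq_minl.
    rewrite -sY; apply: (edge_prefix he) => //; first by rewrite sY hsz; lia.
    rewrite hsz child_lev -subSn; last by lia.
    rewrite -iter_sl_take take_takel; last by lia.
    (* At the start of the task the first letter is right by [dc_first]. Later, [level s p] lies
       inside the task: one level up it is not a node, so it has a single child. *)
    case: (ltngtP p0 p) => h; [|lia|by rewrite -h].
    have eY : take p X = take p Y by apply: h5 => //; lia.
    have [a [_ ea]] := @lev_rcons s p ltac:(lia) ltac:(lia).
    have [b hb] := @onth_ex _ (iter s sl Y) (p - s) ltac:(rewrite size_iter_sl; lia).
    have eb : iter s sl (take p.+1 Y) = rcons (level s p) b.
      by rewrite iter_sl_take subSn; [rewrite (take_onthS hb) -iter_sl_take -eY|lia].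
    rewrite eb ea; congr rcons; apply: (@type1_uniq_child _ _ T (level s p)) => //.
    + rewrite /level eY -(prednK h1) iterS; apply: nonnode_sl.
        by apply/PrevSub_iter_sl/PrevSub_take.
      by apply: h6; lia.
    + by rewrite -eb; apply/PrevSub_iter_sl/PrevSub_take.
    + by rewrite -ea -child_lev; apply/PrevSub_take.
  exists (take q Y); split=> //.
  + by lia.
  + by rewrite size_takel // h3 geq_minl.
  + exact: PrevSub_take.
  + move=> i hi oi; rewrite take_takel; last by lia.
    by apply: h5 => //; lia.
  + move=> i j hi hj; rewrite take_takel; last by lia.
    by apply: h6 => //; lia.
  + move=> i n hi; rewrite onth_take; case: ifP => // _ hY hz.
    by apply: h8 hY hz; lia.
  + move=> oq; case: (leqP qt (size v + s)) => h.
      have eq : q = qt by lia.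
      rewrite eq in oq *; case: (h9 oq) => [|[j hj nj]]; first by left.
      by right; exists j => //; lia.
    have eq : q = size v + s by lia.
    right; exists s => //; have -> : level s q = v; last by [].
    rewrite /level (h5 q) //; last by lia.
    by rewrite ePath eq addnK take_size.
- subst s; have eU i : p <= i <= q -> ok i -> take i X = take i (take q v).
    move=> hi oi; rewrite take_takel; last by lia.
    have si : size (take i X) = i by rewrite size_takel; lia.
    case: (eqVneq i p) => [->|ne].
      have [_ _ e _ _] := (edge_take _ _ _).1 he.
      by move: e; rewrite hsz subn0.
    rewrite -{2}si; apply: (edge_prefix he) => //; rewrite ?si ?hsz ?subn0; first by lia.
    by have := child_lev; rewrite subn0 => ->; rewrite take_takel //; lia.
  exists (take q v); split=> //.
  + by lia.
  + by rewrite size_takel //; lia.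
  + exact: PrevSub_take.
  + by rewrite subn0.
  + move=> i n hi; rewrite onth_take; case: ifP => // _ hY; rewrite subn0 => hz.
    rewrite h3; last by lia.
    by have := vv _ _ hY; rewrite hz => -[].
  + move=> oq; case: (leqP qt (size v + 0)) => h; first by left; lia.
    right; exists 0 => //; rewrite /level (eU q) //; last by lia.
    by rewrite take_takel // take_oversize //; lia.
Qed.

End Select.

(** * Comparing along the chosen edge, or suspending it *)

Section Selected.
Variables (mk : nat -> nat) (s p q : nat) (v Y : pvstring Sigma).
Hypotheses (hs : sel mk s p q v Y) (hsp : s <= p) (hqm : q <= m) (hqv : q <= size v + s).

Lemma sel_onth i : p <= i < q -> onth v (i - s) = omap (zap (i - s)) (onth Y i).
Proof.
move=> hi; have := onth_iter_sl s (i - s) (PrevSub_valid (sel_PS hs)).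
rewrite (sel_path hs) onth_take subnKC; last by lia.
by case: ifP => //; lia.
Qed.

(* The symbol that [pre P] must have at index i, recovered from a label symbol. *)
Definition expected (mk : nat -> nat) i (a : Sigma + nat) : Sigma + nat :=
  if a is inr 0 then inr (mk i) else a.

Lemma sel_expected i a : p <= i < q -> onth v (i - s) = Some a ->
  onth Y i = Some (expected mk i a).
Proof.
move=> hi; rewrite (sel_onth hi); case E: (onth Y i) => [[c|n]|] //=.
  by case=> <-.
case: ltnP => h [<-] /=; first by rewrite (sel_mk hs hi E) //= h.
case: n h E => [|n] h E //=; by rewrite (sel_mk hs hi E).
Qed.

(** [Y] is the only continuation in the trie, so one comparison with its next letter decides about
    the next prefix, whatever the level of the label. *)
Lemma sel_check i a : p <= i < q -> ok i -> onth v (i - s) = Some a ->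
  ok i.+1 <-> onth X i = Some (expected mk i a).
Proof.
move=> hi oi ha; have hY := sel_expected hi ha.
have [b hb] := @onth_ex _ X i ltac:(lia).
split=> [oi1|hX].
  by rewrite -hY; apply: (eq_take_onth (n := i.+1)) => //; apply: (sel_uniq hs) => //; lia.
rewrite /ok (take_onthS hX) (sel_uniq hs _ oi); last by lia.
rewrite -(take_onthS hY); apply: PrevSub_take; exact: sel_PS hs.
Qed.

Lemma sel_end_node : ok q -> q = size v + s -> level s q = v.
Proof.
move=> oq e; rewrite /level (sel_uniq hs _ oq); last by have := sel_lt hs; lia.
by rewrite -{1}(sel_size hs) take_size (sel_path hs) e addnK take_size.
Qed.

Lemma sel_first : iter s sl (take p.+1 Y) = take (p - s).+1 v.
Proof.
rewrite iter_sl_take (sel_path hs) take_takel; first by congr take; lia.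
by have := sel_lt hs; lia.
Qed.

(** The letter found by [Re] has value [i - s], its own index at level [s]. References are
    distances, so a surviving one has this value at level 0 too. The last test drops a position
    beyond the end of the task. *)
Definition mark u v mk : nat -> nat := fun i =>
  if [&& 0 < Re u v, i.+1 == p + Re u v & p + Re u v <= q] then i - s else mk i.

(** A 0 at the new level is a letter that was erased before and keeps its mark, or a true 0, or the
    letter marked now; [fl_refs] leaves no other source. *)
Lemma push_ctx w k : edge (level s p) v ->
  onth v (p - s) = onth (iter s sl X) (p - s) ->
  fast_link_spec T (level s p) v w k -> s + k <= p ->
  ctx true (mark (level s p) v mk) (s + k) p q p.
Proof.
move=> he hv [k0 hk ew nw fi fr fs] hskp.
have hpq := sel_lt hs; have hsz := @size_lev s p ltac:(lia).
have [pu pv] := edge_PrevSub he.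
have un : level s p <> [::] by move/(congr1 size); rewrite hsz /=; lia.
exists Y; split=> //.
- by lia.
- exact: sel_size hs.
- exact: sel_PS hs.
- exact: sel_uniq hs.
- move=> i j hi hj; case: (ltnP j s) => h; first by apply: (sel_inner hs).
  have -> : iter j sl (take i Y) = iter (j - s) sl (take (i - s) v).
    have -> : iter j sl (take i Y) = iter (j - s) sl (iter s sl (take i Y)) by rewrite -iterD subnK.
    by rewrite (iter_sl_take s) (sel_path hs) take_takel //; lia.
  by apply: fi; rewrite ?hsz; lia.
- rewrite addnC iterD sel_first /level iterD; congr iter.
  have [a [ha ea]] := @lev_rcons s p ltac:(lia) ltac:(lia).
  rewrite -/(level s p.+1) ea -hsz; apply: (child_take he).
  by rewrite hsz hv.
- move=> i n hi hY; rewrite /mark; have hvi := sel_onth hi.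
  rewrite hY /= in hvi.
  case: (ltnP (i - s) n) => hn.
    (* already 0 at level s *)
    move=> _; case: ifP => [/and3P[r0 /eqP er rq]|_].
      (* An old mark is not overwritten: the letter found by [Re] is nonzero, while this one is
         already 0. *)
      have [[r00]|[l [hl hvl rl]]] := ReP he un; first by lia.
      rewrite hsz in hl rl; have el : l = i - s by lia.
      subst l; move: hvl; rewrite hvi hn => -[]; lia.
    by apply: (sel_mk hs hi hY); rewrite /= hn.
  rewrite ltnNge hn /= in hvi.
  rewrite /=; case: ltnP => hn2 e; last first.
    case: e => n0; subst n; rewrite (sel_mk hs hi hY) //.
    case: ifP => // /and3P[r0 /eqP er rq].
    have [[r00]|[l [hl hvl rl]]] := ReP he un; first by lia.
    rewrite hsz in hl rl; have el : l = i - s by lia.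
    subst l; move: hvl; rewrite hvi => -[]; lia.
  have vY := PrevSub_valid (sel_PS hs) hY.
  have en : n = i - s.
    by apply: (fr (i - s)) => //; rewrite ?hsz; lia.
  have sv := onth_size hvi; rewrite en in hvi.
  have eR : Re (level s p) v = (i - s).+1 - (p - s).
    by rewrite -hsz; apply: (Re_uniq he) => //; rewrite hsz; lia.
  by rewrite eR ifT; lia.
- move=> oq; case: (sel_end hs oq) => [|[j hj nj]]; first by left.
  by right; exists j => //; lia.
Qed.

End Selected.

(** * The potential that pays for pushes *)

Section Potential.
Variables (A B M : nat).
Hypotheses (hM : forall i, i <= m -> ok i <-> i <= M) (hMm : M <= m).
(** Indices below [N] are the matching ones and the first mismatch, beyond which nothing is
    compared. *)
Let N := minn m M.+1.

Definition direct u v := size v - size u = 1 \/ ~ (good T u /\ good T v).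

(** This turns from true to false between levels s' and s' + 1 exactly when the letter refers to the
    first symbol at level s'. *)
Definition refat s i : bool :=
  if onth X i is Some (inr n) then 0 < n <= i - s else false.

Definition nonodes s i : bool := `[< forall j, j <= s -> ~ node (level j i) >].

Definition zeroat s i : bool :=
  (s <= i) && (onth (iter s sl X) (i - s) == Some (inr 0)).

(* The charges that the symbol at index i can still pay at levels above s. *)
Definition psi s i : nat :=
  refat s.+1 i + nonodes s i.+1
  + \sum_(s.+1 <= s' < m.+1) ((M <= i.+1) || zeroat s' i.+1).

Lemma zeroatE s i : s <= i ->
  zeroat s i = (omap (zap (i - s)) (onth X i) == Some (inr 0)).
Proof. by move=> h; rewrite /zeroat h onth_iter_sl // subnKC. Qed.

Lemma zeroat_le s s' i : s <= s' <= i -> zeroat s i -> zeroat s' i.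
Proof.
move=> h; rewrite !zeroatE; try lia.
case E: (onth X i) => [a|] //= /eqP[e]; apply/eqP.
by rewrite -(zap_zap (j := i - s)) ?e //; lia.
Qed.

Lemma refat_le s s' i : s <= s' -> refat s' i <= refat s i.
Proof. by rewrite /refat; case: (onth X i) => [[c|n]|] //=; lia. Qed.

Lemma nonodes_le s s' i : s <= s' -> nonodes s' i <= nonodes s i.
Proof.
move=> h; case: (boolP (nonodes s' i)) => // /asboolP h'.
suff -> : nonodes s i by [].
by apply/asboolP => j hj; apply: h'; lia.
Qed.

Lemma psi_le s s' i : s <= s' -> psi s' i <= psi s i.
Proof.
move=> h; rewrite /psi !leq_add ?refat_le ?nonodes_le //.
case: (leqP s' m) => h'; last by rewrite [X in X <= _]big_geq //; lia.
rewrite [X in _ <= X](big_cat_nat (n := s'.+1)) //=; lia.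
Qed.

(** A node or a task end at length [i + 1] is charged to its last symbol, at index [i]; a letter
    found by [Re] is charged to its own index. *)
Lemma psi_lt s s' i : s < s' ->
  [\/ refat s' i /\ ~~ refat s'.+1 i,
      nonodes s i.+1 /\ node (level s' i.+1)
    | s' <= m /\ (M <= i.+1) || zeroat s' i.+1] ->
  psi s' i < psi s i.
Proof.
move=> h H.
have h1 := @refat_le s.+1 s' i h; have h2 := @refat_le s' s'.+1 i (leqnSn _).
have h3 := @nonodes_le s s' i.+1 (ltnW h).
have h4 : \sum_(s'.+1 <= j < m.+1) ((M <= i.+1) || zeroat j i.+1 : nat)
       <= \sum_(s.+1 <= j < m.+1) ((M <= i.+1) || zeroat j i.+1 : nat).
  case: (leqP s' m) => h'; last by rewrite [X in X <= _]big_geq //; lia.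
  rewrite [X in _ <= X](big_cat_nat (n := s'.+1)) //=; lia.
case: H => [[r1 r2]|[n1 n2]|[sm hz]].
- by rewrite /psi; move: r2 h1; rewrite r1; case: (refat s'.+1 i) => //; lia.
- rewrite /psi n1; have -> : nonodes s' i.+1 = false.
    by apply/asboolP => /(_ s' (leqnn _)).
  by rewrite /=; lia.
- rewrite /psi; suff : \sum_(s'.+1 <= j < m.+1) ((M <= i.+1) || zeroat j i.+1 : nat)
       < \sum_(s.+1 <= j < m.+1) ((M <= i.+1) || zeroat j i.+1 : nat) by lia.
  rewrite [X in _ < X](big_cat_nat (n := s')) //=; last by lia.
  by rewrite [X in _ < _ + X]big_ltn ?ltnS //= hz; lia.
Qed.

(** As [q < M], the next symbol of the pattern extends the node at level [j], so [bad_suffix_zero]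
    applies to it. *)
Lemma zeroat_nonnode j j' q : j <= j' <= q -> q < M -> node (level j q) ->
  ~ node (level j' q) -> zeroat j' q.
Proof.
move=> hj hq nj nj'.
have [a [ha ea]] := @lev_rcons j q ltac:(lia) ltac:(lia).
have pa : PS (rcons (level j q) a).
  by rewrite -ea; apply: PrevSub_iter_sl; apply/(hM _).2 => //; lia.
have sz := @size_lev j q ltac:(lia).
have e : level j' q = iter (j' - j) sl (level j q) by rewrite /level -iterD subnK //; lia.
have := @bad_suffix_zero _ _ T (j' - j) _ _ nj pa; rewrite sz -e => /(_ _ nj') H.
have {}H : zap (q - j - (j' - j)) a = inr 0 by apply: H; lia.
rewrite zeroatE; last by lia.
rewrite onth_iter_sl // subnKC in ha; last by lia.
case: (onth X q) ha => [b|] //= [ha]; subst a; apply/eqP; congr Some.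
by rewrite -(zap_zap (j := q - j)) -?H; [congr zap|]; lia.
Qed.

Lemma push_drop mk s p q v Y w k : sel mk s p q v Y -> s <= p -> q <= m ->
  q <= size v + s -> edge (level s p) v ->
  fast_link_spec T (level s p) v w k -> s + k <= p -> p <= M ->
  (exists i, [/\ p <= i < q, i < N & psi (s + k) i < psi s i]) \/
  (forall v', edge w v' ->
     onth v' (p - (s + k)) = onth (iter (s + k) sl X) (p - (s + k)) -> direct w v').
Proof.
move=> hs sp qm qv he [k0 hk ew nw fi fr fs] skp pM.
have hpq := sel_lt hs.
(* A task reaching past [M] is paid by index [M], through the free charge. *)
case: (ltnP M q) => hMq.
  left; exists M; split; [lia|rewrite /N; lia|].
  by apply: psi_lt; [lia|apply: Or33; split; [lia|rewrite leqnSn]].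
case: (EM (forall v', edge w v' -> onth v' (p - (s + k)) =
   onth (iter (s + k) sl X) (p - (s + k)) -> direct w v')) => [|/existsNP[v']]; first by right.
move=> /not_implyP[he' /not_implyP[hv' nd]]; left.
have hsz := @size_lev s p ltac:(lia).
set s' := s + k in skp hv' *.
have ew' : w = level s' p by rewrite ew /level -iterD addnC.
have szw : size w = p - s' by rewrite ew' size_lev //; lia.
have [_ nv' _ lt' hin'] := (edge_take _ _ _).1 he'.
have [ngw ngv'] : good T w /\ good T v'.
  by apply: contrapT => h; apply: nd; right.
have okM i : i <= M -> ok i by move=> hi; apply/hM => //; lia.
have key i : p < i <= M -> i <= size v' + s' -> level s' i = take (i - s') v'.
  move=> hi hi'; have szi : size (level s' i) = i - s' by rewrite size_lev //; lia.
  rewrite -szi; apply: (edge_prefix he'); rewrite ?szi ?szw; last 2 first.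
  - by lia.
  - have [a [ha ea]] := @lev_rcons s' p ltac:(lia) ltac:(lia).
    rewrite -szw (child_take he' (a := a)); last by rewrite szw hv'.
    rewrite szw ew' -ea /level !iter_sl_take take_takel; last by lia.
    by congr take; lia.
  - by apply/PrevSub_iter_sl/okM; lia.
have levs i : p < i <= q -> level s i = take (i - s) v.
  move=> hi; rewrite /level (sel_uniq hs) //; [|lia|apply: okM; lia].
  by rewrite iter_sl_take (sel_path hs) take_takel //; lia.
rewrite szw in lt' hin'.
(* If [v'] ends inside the task, then no level up to [s] had a node at that position. *)
case: (ltnP (size v' + s') q) => hr.
  exists (size v' + s').-1; split; [lia|rewrite /N; lia|].
  apply: psi_lt; [lia|apply: Or32].
  rewrite prednK; last by lia.
  split; last by rewrite key ?addnK ?take_size //; lia.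
  apply/asboolP => j; rewrite leq_eqVlt => /orP[/eqP->|hj].
    rewrite levs; last by lia.
    by apply: (fi (size v' + s' - s) 0) => //; rewrite hsz; lia.
  rewrite /level (sel_uniq hs); [|lia|apply: okM; lia].
  by apply: (sel_inner hs) => //; lia.
have Z : (M <= q) || zeroat s' q ->
    exists i, [/\ p <= i < q, i < N & psi s' i < psi s i].
  move=> hz; exists q.-1; split; [lia|rewrite /N; lia|].
  apply: psi_lt; [lia|apply: Or33; split; [lia|]].
  by rewrite prednK //; lia.
case: (leqP M q) Z => hMq2 Z; first by apply: Z.
have [|[j hj nj]] := sel_end hs (okM _ hMq); first by lia.
case: (EM (node (level s' q))) => nq; last first.
  by apply: Z; apply: (@zeroat_nonnode j s') => //; lia.
have eq : level s' q = take (q - s') v' by apply: key; lia.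
have sv' : size v' = q - s'.
  apply/eqP; rewrite eqn_leq; apply/andP; split; last by lia.
  rewrite leqNgt; apply/negP => hlt; apply: (hin' (q - s')); first by lia.
  by rewrite -eq.
rewrite -sv' take_size in eq.
(* If the task ends inside the edge to [v], the next symbol is 0 already at level [s], and zeros
   persist at deeper levels. *)
case: (ltnP q (size v + s)) => hq2.
  apply: Z; apply: (@zeroat_le s); first by lia.
  apply: (@zeroat_nonnode j s) => //; first by lia.
  rewrite levs; last by lia.
  by apply: (fi (q - s) 0) => //; rewrite hsz; lia.
have eq2 : q = size v + s by lia.
have ev : level s q = v by rewrite levs ?eq2 ?addnK ?take_size //; lia.
have ev' : iter k sl v = v' by rewrite -ev /level -iterD (addnC k) -/(level s' q) eq.
(* Now both edges end at [q], so the next edge is not too short, and [w] is good. The link stopped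
   because of [Re], and the letter found there pays. *)
have fs' := fs; rewrite /fast_link_stop -ew ev' in fs'.
case: fs' => [[a [vk [ha [ek hk'] hst]]]|//].
have ? : vk = v'.
  apply: (edge_child_uniq ek he' (a := a)); first exact/(child_onth _ ek).
  exact/(child_onth _ he').
subst vk; case: hst => [|rp]; first by lia.
have wn : w <> [::] by case: ngw.
have [[r0 _]|[l [hl hvl _]]] := ReP he' wn; first by lia.
rewrite szw in hl.
have w0 : 0 < size w by case: (w) wn.
have Xl : onth X (l + s') = Some (inr l).
  have := onth_take (iter s' sl X) (q - s') l.
  rewrite -iter_sl_take -/(level s' q) eq hvl ifT; last by lia.
  rewrite onth_iter_sl // addnC; case: (onth X _) => [[c|n]|] //=.
  by case: ltnP => _ [] ?; congr (Some (inr _)); lia.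
exists (l + s'); split; [lia|rewrite /N; lia|].
apply: psi_lt; [lia|apply: Or31].
by rewrite /refat Xl; split; lia.
Qed.

(** [A] is the price of a symbol and [B] that of a push. *)
Definition Phi s p q : nat := \sum_(p <= i < q | i < N) (A + B * psi s i).

Lemma Phi_le s s' p q : s <= s' -> Phi s' p q <= Phi s p q.
Proof.
move=> h; rewrite /Phi; apply: leq_sum => i _.
by rewrite leq_add2l leq_mul2l psi_le ?orbT.
Qed.

Lemma Phi_cat s p r q : p <= r <= q -> Phi s p q = Phi s p r + Phi s r q.
Proof. by case/andP=> h1 h2; rewrite /Phi (big_cat_nat (n := r)). Qed.

Lemma Phi_nil s p : Phi s p p = 0.
Proof. by rewrite /Phi big_geq. Qed.

Lemma Phi_lt s s' p q i : s <= s' -> p <= i < q -> i < N -> psi s' i < psi s i ->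
  Phi s' p q + B <= Phi s p q.
Proof.
move=> h hi hN hlt; rewrite !(@Phi_cat _ p i q); try lia.
rewrite !(@Phi_cat _ i i.+1 q); try lia.
have h1 := @Phi_le s s' p i h; have h2 := @Phi_le s s' i.+1 q h.
suff : Phi s' i i.+1 + B <= Phi s i i.+1 by lia.
rewrite /Phi big_mkcond big_nat1 hN [X in _ <= X]big_mkcond big_nat1 hN.
by rewrite -addnA leq_add2l -mulnSr leq_mul2l hlt orbT.
Qed.

Lemma Phi_ge s p q : q <= N -> A * (q - p) <= Phi s p q.
Proof.
move=> h; rewrite -(mulnC (q - p)) -sum_nat_const_nat /Phi [X in _ <= X]big_mkcond.
rewrite big_nat [X in _ <= X]big_nat; apply: leq_sum => i /andP[_ hi].
by rewrite ifT ?leq_addr //; lia.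
Qed.

(** Each of the [m] levels contributes at most [z] zeros and the two indices below [N] with
    [M <= i + 1]. The other two terms of [psi] are at most 1 per symbol, whence [z + 4]. *)
Lemma Phi_total z : (forall s, count_mem (inr 0) (iter s sl X) <= z) ->
  Phi 0 0 m <= (A + B * (z + 4)) * m.
Proof.
move=> hz.
have cnt s' : \sum_(0 <= i < m | i < N) ((M <= i.+1) || zeroat s' i.+1) <= z + 2.
  apply: (@leq_trans (\sum_(0 <= i < m | i < N) (M <= i.+1) + \sum_(0 <= i < m) zeroat s' i.+1)).
    rewrite [X in _ <= _ + X](bigID (fun i => i < N)) /= addnA.
    apply: leq_trans (leq_addr _ _); rewrite -big_split /=.
    by apply: leq_sum => i _; case: (M <= _) => //=; case: (zeroat _ _).
  rewrite addnC leq_add //.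
    apply: leq_trans (hz s').
    rewrite -sum1_count (big_nth (inr 0)) size_iter_sl.
    apply: (@leq_trans (\sum_(0 <= i < m.+1) zeroat s' i)).
      by rewrite big_nat_recl // leq_addl.
    case: (leqP s' m) => hsm; last first.
      rewrite big_nat big1 // => i hi; rewrite /zeroat; case: leqP => //; lia.
    rewrite (big_cat_nat (n := s')) //=; last by lia.
    rewrite [X in X + _]big_nat big1 ?add0n; last by move=> i hi; rewrite /zeroat; case: leqP => //; lia.
    rewrite -{1}(add0n s') big_addn subSn // big_nat_recr //=.
    rewrite [zeroat _ _]negbTE ?addn0; last first.
      by rewrite /zeroat onth_default ?andbF // size_iter_sl; lia.
    rewrite [X in _ <= X]big_mkcond; apply: leq_sum => i _; rewrite /zeroat leq_addl addnK /=.
    by case: eqP => //= h; rewrite (onth_nth _ _ _ _ h) eqxx.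
  rewrite -big_mkcondr /= sum1_count.
  apply: (@leq_trans (size [:: M.-1; M])) => //.
  rewrite -size_filter; apply: uniq_leq_size; first exact/filter_uniq/iota_uniq.
  by move=> i; rewrite mem_filter !inE /N mem_index_iota; lia.
rewrite /Phi big_split /= -big_distrr /= mulnDl leq_add //.
  rewrite big_mkcond /=; apply: (@leq_trans (\sum_(0 <= i < m) A)).
    by apply: leq_sum => i _; case: ifP.
  by rewrite sum_nat_const_nat subn0 mulnC.
rewrite -mulnA leq_mul2l; apply/orP; right.
have -> : (z + 4) * m = m + m + (z + 2) * m by lia.
rewrite /psi !big_split /= !leq_add //.
- rewrite big_mkcond /=; apply: (@leq_trans (\sum_(0 <= i < m) 1)).
    by apply: leq_sum => i _; case: ifP => // _; case: (refat _ _).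
  by rewrite sum_nat_const_nat subn0 muln1.
- rewrite big_mkcond /=; apply: (@leq_trans (\sum_(0 <= i < m) 1)).
    by apply: leq_sum => i _; case: ifP => // _; case: (nonodes _ _).
  by rewrite sum_nat_const_nat subn0 muln1.
rewrite exchange_big /=; apply: (@leq_trans (\sum_(1 <= s' < m.+1) (z + 2))).
  by apply: leq_sum.
by rewrite sum_nat_const_nat subn1 mulnC.
Qed.

End Potential.
End Match.

(** * The program *)

Import Order.TTheory GRing.Theory Num.Theory.

(** Total correctness with [n] as time credit; the postcondition receives the unspent credit. *)
Definition wp (W : nat) (c : cmd) (n : nat) (s : state) (Q : nat -> state -> Prop) :=
  exists t s', [/\ exec W c s t s', t <= n & Q (n - t) s'].

Section WP.
Variable W : nat.
Implicit Types (Q : nat -> state -> Prop) (P : state -> Prop).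

Lemma wp_skip n s Q : 0 < n -> Q n.-1 s -> wp W Skip n s Q.
Proof. by move=> h q; exists 1, s; split=> //; [constructor|rewrite subn1]. Qed.

Lemma wp_set n s r e Q : 0 < n -> in_word W (eval s e) ->
  Q n.-1 (set_reg s r (eval s e)) -> wp W (SetReg r e) n s Q.
Proof.
by move=> h i q; exists 1, (set_reg s r (eval s e)); split=> //; [constructor|rewrite subn1].
Qed.

Lemma wp_put n s a e1 e2 Q : 0 < n -> in_word W (eval s e1) -> in_word W (eval s e2) ->
  Q n.-1 (set_cell s a (eval s e1) (eval s e2)) -> wp W (Put a e1 e2) n s Q.
Proof.
move=> h i j q; exists 1, (set_cell s a (eval s e1) (eval s e2)).
by split=> //; [constructor|rewrite subn1].
Qed.

Lemma wp_seq c1 c2 n s Q :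
  wp W c1 n s (fun n1 s1 => wp W c2 n1 s1 Q) -> wp W (Seq c1 c2) n s Q.
Proof.
move=> [t1 [s1 [e1 l1 [t2 [s2 [e2 l2 q]]]]]]; exists (t1 + t2), s2; split.
- exact: ExecSeq e1 e2.
- lia.
- by rewrite subnDA.
Qed.

Lemma wp_if b c1 c2 n s Q : 0 < n ->
  (eval_test s b -> wp W c1 n.-1 s Q) -> (~~ eval_test s b -> wp W c2 n.-1 s Q) ->
  wp W (If b c1 c2) n s Q.
Proof.
move=> n0 h1 h2; case: (boolP (eval_test s b)) => hb.
  have [t [s' [e l q]]] := h1 hb; exists t.+1, s'; split; [exact: ExecIfTrue|lia|].
  by have -> : n - t.+1 = n.-1 - t by lia.
have [t [s' [e l q]]] := h2 hb; exists t.+1, s'; split; [exact: ExecIfFalse|lia|].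
by have -> : n - t.+1 = n.-1 - t by lia.
Qed.

(** Every test consumes credit, so induction on the credit yields termination, and the invariant
    itself carries the cost analysis. *)
Lemma wp_while (I : nat -> state -> Prop) b c Q :
  (forall n s, I n s -> 0 < n /\
     (if eval_test s b then wp W c n.-1 s I else Q n.-1 s)) ->
  forall n s, I n s -> wp W (While b c) n s Q.
Proof.
move=> h n; have [k] := ubnP n; elim: k n => // k IH n hk s i.
have [n0] := h _ _ i; case: ifP => hb.
  move=> [t [s1 [e l i1]]].
  have [|t2 [s2 [e2 l2 q]]] := IH (n.-1 - t) _ _ i1; first by lia.
  exists (t + t2).+1, s2; split; [exact: ExecWhileTrue e e2|lia|].
  by have -> : n - (t + t2).+1 = n.-1 - t - t2 by lia.
move=> q; exists 1, s; split=> //; last by rewrite subn1.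
by constructor; rewrite hb.
Qed.

Lemma wp_call t P c n s Q : wp W c t s (fun _ s' => P s') -> t <= n ->
  (forall n' s', n - t <= n' -> P s' -> Q n' s') -> wp W c n s Q.
Proof.
move=> [t' [s' [e l p]]] tn h; exists t', s'; split=> //; first by lia.
by apply: h => //; lia.
Qed.

Lemma wp_weaken c n s (Q Q' : nat -> state -> Prop) : wp W c n s Q ->
  (forall n' s', Q n' s' -> Q' n' s') -> wp W c n s Q'.
Proof. by move=> [t [s' [e l p]]] h; exists t, s'; split=> //; apply: h. Qed.

Lemma in_wordP z : (- W%:Z <= z <= W%:Z)%R -> in_word W z.
Proof. by rewrite /in_word ler_norml. Qed.

End WP.

(* rS is the level, rU the current node, rP the position of P reached so far,
   rQ the position where the current task ends, rD the height of the stack, rX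
   the current edge and rA the next symbol of P at the current level. *)
Local Notation rGo := 3 (only parsing).
Local Notation rS := 4 (only parsing).
Local Notation rU := 5 (only parsing).
Local Notation rQ := 6 (only parsing).
Local Notation rD := 7 (only parsing).
Local Notation rP := 8 (only parsing).
Local Notation rA := 9 (only parsing).
Local Notation rE := 10 (only parsing).
Local Notation rX := 11 (only parsing).
Local Notation rB := 12 (only parsing).
Local Notation rV := 13 (only parsing).
Local Notation rI := 14 (only parsing).
Local Notation rR := 15 (only parsing).
Local Notation rEnd := 16 (only parsing).
Local Notation aPre := 14 (only parsing).
Local Notation aLast := 15 (only parsing).
Local Notation aMk := 16 (only parsing).
Local Notation aStS := 17 (only parsing).
Local Notation aStU := 18 (only parsing).
Local Notation aStQ := 19 (only parsing).

Local Notation "c1 ;; c2" := (Seq c1 c2) (at level 90, right associativity).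

Definition c_text : cmd :=
  SetReg rB (Get aText (Reg rI)) ;;
  If (TLt (Reg rB) (Cst 0)) Skip
  (If (TLt (Reg rB) (Plus (Minus (Reg rI) (Get aEdgeK (Reg rX))) (Cst 1))) Skip
      (SetReg rB (Cst 0))).

Definition c_sym : cmd :=
  let text := SetReg rI (Get aEdgeI (Reg rX)) ;; c_text in
  let stored := SetReg rB (Get aEdgeSym (Reg rX)) in
  If (TEq (Get aEdgeUnit (Reg rX)) (Cst 1)) stored
  (If (TEq (Get aNodeSL (Reg rU)) (Cst (-1))) text
  (If (TEq (Get aNodeSL (Get aEdgeTo (Reg rX))) (Cst (-1))) text stored)).

(** [rE] controls the loop, so that [rX] still holds the edge found when the loop is left. *)
Definition c_search : cmd :=
  SetReg rX (Get aNodeEdges (Reg rU)) ;;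
  SetReg rE (Reg rX) ;;
  While (TLt (Cst (-1)) (Reg rE))
    (c_sym ;;
     If (TEq (Reg rB) (Reg rA)) (SetReg rE (Cst (-1)))
       (SetReg rX (Get aEdgeNext (Reg rX)) ;; SetReg rE (Reg rX))).

(** Clearing [rEnd] also ends the loop of [c_leaf] when the rejection happens inside it. *)
Definition c_reject : cmd :=
  SetReg rOut (Cst 0) ;; SetReg rGo (Cst 0) ;; SetReg rEnd (Cst 0).

Definition c_check : cmd :=
  If (TEq (Reg rB) (Cst 0)) (SetReg rB (Get aMk (Plus (Reg rP) (Cst 1)))) Skip ;;
  If (TEq (Reg rB) (Get aPre (Plus (Reg rP) (Cst 1))))
     (SetReg rP (Plus (Reg rP) (Cst 1)))
     c_reject.

Definition c_leaf : cmd :=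
  SetReg rI (Get aEdgeI (Reg rX)) ;;
  While (TLt (Reg rP) (Reg rEnd))
    (c_text ;; SetReg rI (Plus (Reg rI) (Cst 1)) ;; c_check).

Definition c_end : cmd :=
  SetReg rEnd (Plus (Get aNodeLen (Get aEdgeTo (Reg rX))) (Reg rS)) ;;
  If (TLt (Reg rQ) (Reg rEnd)) (SetReg rEnd (Reg rQ)) Skip.

Definition c_mark : cmd :=
  SetReg rR (Get aNodeRe (Reg rV)) ;;
  If (TLt (Cst 0) (Reg rR))
    (If (TLt (Reg rEnd) (Plus (Reg rP) (Reg rR))) Skip
       (Put aMk (Plus (Reg rP) (Reg rR))
          (Minus (Plus (Minus (Reg rP) (Reg rS)) (Reg rR)) (Cst 1))))
    Skip.

Definition c_push : cmd :=
  SetReg rV (Get aEdgeTo (Reg rX)) ;;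
  c_mark ;;
  Put aStS (Reg rD) (Reg rS) ;;
  Put aStU (Reg rD) (Reg rV) ;;
  Put aStQ (Reg rD) (Reg rQ) ;;
  SetReg rD (Plus (Reg rD) (Cst 1)) ;;
  SetReg rQ (Reg rEnd) ;;
  SetReg rR (Get aEdgeFL (Reg rX)) ;;
  SetReg rS (Plus (Reg rS) (Minus (Get aNodeLen (Reg rU)) (Get aNodeLen (Reg rR)))) ;;
  SetReg rU (Reg rR).

Definition c_pop : cmd :=
  If (TEq (Reg rD) (Cst 0))
    (SetReg rOut (Cst 1) ;; SetReg rGo (Cst 0))
    (SetReg rD (Minus (Reg rD) (Cst 1)) ;;
     SetReg rS (Get aStS (Reg rD)) ;;
     SetReg rU (Get aStU (Reg rD)) ;;
     SetReg rQ (Get aStQ (Reg rD))).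

Definition c_symP : cmd :=
  SetReg rA (Get aPre (Plus (Reg rP) (Cst 1))) ;;
  If (TLt (Reg rA) (Minus (Plus (Reg rP) (Cst 1)) (Reg rS))) Skip (SetReg rA (Cst 0)).

Definition c_edge : cmd :=
  let leaf := c_leaf ;; SetReg rU (Get aEdgeTo (Reg rX)) in
  c_end ;;
  If (TEq (Get aEdgeUnit (Reg rX)) (Cst 1))
    (SetReg rB (Reg rA) ;; c_check ;; SetReg rU (Get aEdgeTo (Reg rX)))
  (If (TEq (Get aNodeSL (Reg rU)) (Cst (-1))) leaf
  (If (TEq (Get aNodeSL (Get aEdgeTo (Reg rX))) (Cst (-1))) leaf c_push)).

Definition c_body : cmd :=
  If (TLt (Reg rP) (Reg rQ))
    (c_symP ;; c_search ;;
     If (TLt (Reg rX) (Cst 0)) c_reject c_edge)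
    c_pop.

Definition c_pre (npar : nat) : cmd :=
  SetReg rI (Cst 0) ;;
  While (TLt (Reg rI) (Cst npar%:Z))
    (Put aLast (Reg rI) (Cst 0) ;; SetReg rI (Plus (Reg rI) (Cst 1))) ;;
  SetReg rI (Cst 0) ;;
  While (TLt (Reg rI) (Reg rLen))
    (SetReg rI (Plus (Reg rI) (Cst 1)) ;;
     Put aMk (Reg rI) (Cst 0) ;;
     SetReg rA (Get aPattern (Reg rI)) ;;
     If (TLt (Reg rA) (Cst 0)) (Put aPre (Reg rI) (Reg rA))
       (If (TEq (Get aLast (Reg rA)) (Cst 0)) (Put aPre (Reg rI) (Cst 0))
           (Put aPre (Reg rI) (Minus (Reg rI) (Get aLast (Reg rA)))) ;;
        Put aLast (Reg rA) (Reg rI))).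

Definition c_main (npar : nat) : cmd :=
  c_pre npar ;;
  SetReg rS (Cst 0) ;; SetReg rU (Reg rRoot) ;; SetReg rQ (Reg rLen) ;;
  SetReg rD (Cst 0) ;; SetReg rP (Cst 0) ;; SetReg rGo (Cst 1) ;;
  While (TEq (Reg rGo) (Cst 1)) c_body.

Definition frame (rs : seq nat) (s s' : state) :=
  arr s' = arr s /\ forall r, r \notin rs -> reg s' r = reg s r.

Lemma code_pvsym_inj (Sigma : finType) : injective (@code_pvsym Sigma).
Proof.
move=> [a|n] [b|k] //= h; try lia; last by congr inr; lia.
by congr inl; apply: enum_rank_inj; apply: val_inj => /=; lia.
Qed.

Lemma code_pvsym0 (Sigma : finType) (a : Sigma + nat) : (code_pvsym a == 0%R) = (a == inr 0).
Proof. by rewrite -(inj_eq (@code_pvsym_inj Sigma)). Qed.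

Ltac inword := apply: in_wordP => /=; lia.

(** * Running the program on a stored tree *)

Section Memory.
Variables (Sigma Pi : finType) (T : pstring Sigma Pi) (W : nat) (s0 : state).
Variables (node_at edge_at : pvstring Sigma -> int) (T' : pvstring Sigma).
Hypothesis hnode : forall u, plst_node T u ->
  (0 <= node_at u)%R /\ stores_node T s0 node_at edge_at u.
Hypothesis hedge : forall u v, plst_edge T u v ->
  (0 <= edge_at v)%R /\ stores_edge T s0 node_at edge_at T' u v.
Hypothesis htext : forall i a, onth T' i = Some a ->
  arr s0 aText (Posz i.+1) = code_pvsym a.
Hypothesis hword : forall a i, in_word W (arr s0 a i).
Variable Wb : nat.
Hypotheses (hWb : 4 * W + 4 <= Wb) (hSb : #|Sigma| <= Wb).

Local Notation node := (@plst_node Sigma Pi T).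
Local Notation edge := (@plst_edge Sigma Pi T).

Definition mem (s : state) := forall a i, a < 14 -> arr s a i = arr s0 a i.

Lemma mem_frame rs s s' : mem s -> frame rs s s' -> mem s'.
Proof. by move=> h [e _] a i ha; rewrite e h. Qed.

Lemma get_word a i : (- W%:Z <= arr s0 a i <= W%:Z)%R.
Proof. by have := hword a i; rewrite /in_word ler_norml. Qed.

Lemma mem_word s a i : mem s -> a < 14 -> in_word Wb (arr s a i).
Proof. by move=> h ha; have := get_word a i; rewrite h // => ?; inword. Qed.

Definition text_sym (k : int) (i : nat) : option (Sigma + nat) :=
  omap (ang_sym k i) (onth T' i.-1).

Lemma wp_text s i k a : mem s -> reg s rI = Posz i -> 0 < i ->
  arr s0 aEdgeK (reg s rX) = k -> text_sym k i = Some a ->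
  wp Wb c_text 4 s (fun _ s' => frame [:: rB] s s' /\ reg s' rB = code_pvsym a).
Proof.
move=> hm hi i0 hk; rewrite /text_sym; case E: (onth T' i.-1) => [t|] //= [ha].
have ht := htext E; rewrite prednK // in ht.
apply: wp_seq; apply: wp_set => //=; first exact: mem_word.
have fr : frame [:: rB] s (set_reg s rB (arr s aText (reg s rI))).
  by split=> //= r; rewrite inE => /negbTE ->.
apply: wp_if => //= h1.
  apply: wp_skip => //=; split=> //; rewrite hm // hi ht; move: h1.
  rewrite hm // hi ht -ha; by case: (t) => [c|n] //=.
apply: wp_if => //= h2.
  apply: wp_skip => //=; split=> //; rewrite hm // hi ht; move: h2.
  rewrite !hm // hi ht hk -ha; case: (t) h1 => [c|n] //= h1 h2.
  by rewrite ifF //; lia.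
apply: wp_set => //=.
split; first by split=> //= r; rewrite inE => /negbTE ->.
rewrite /= -ha; move: h1 h2; rewrite !hm // hi ht hk; case: (t) => [c|n] //= _ h2.
by rewrite ifT //; lia.
Qed.

Lemma sl_bad u : node u -> (arr s0 aNodeSL (node_at u) == (-1)%R) <-> ~ good T u.
Proof.
move=> nu; have [_ [_ _ h1 h2 _]] := hnode nu.
split=> [/eqP e gu|/h2 -> //]; rewrite (h1 gu) in e.
have [_ _ /hnode[]] := gu; lia.
Qed.

Lemma edge_triple u v : edge u v -> direct T u v -> size v - size u <> 1 ->
  exists i k, [/\ arr s0 aEdgeI (edge_at v) = Posz i, arr s0 aEdgeK (edge_at v) = k,
    0 < i & forall t, t < size v - size u -> text_sym k (i + t) = onth v (size u + t)].
Proof.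
move=> he hd h1; have [_ [_ _ _ h _]] := hedge he.
have [|i [j [k [[i1 _ _ e] ei _ ek]]]] := h; first by case: hd => h' [].
exists i, k; split=> // t ht.
have := congr1 (fun w => onth w t) e.
rewrite /str onth_drop => ->.
have : t < size (str u v) by rewrite size_drop.
rewrite e /sub_string size_take_min onth_take onth_drop /text_sym /ang onth_imap1.
move=> hm; rewrite ifT; last by lia.
have -> : (i.-1 + t).+1 = i + t by lia.
by have -> : (i + t).-1 = i.-1 + t by lia.
Qed.

Lemma edge_unit u v : edge u v ->
  (arr s0 aEdgeUnit (edge_at v) == 1%R) = (size v - size u == 1).
Proof. by move=> he; have [_ [_ -> _ _ _]] := hedge he; case: (_ == 1). Qed.

Lemma edge_to u v : edge u v -> arr s0 aEdgeTo (edge_at v) = node_at v.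
Proof. by move=> he; have [_ [-> _ _ _ _]] := hedge he. Qed.

Lemma edge_sym u v : edge u v -> size v - size u = 1 \/ good T u /\ good T v ->
  exists2 a, onth v (size u) = Some a & arr s0 aEdgeSym (edge_at v) = code_pvsym a.
Proof.
move=> he h; have [_ [_ _ /(_ h)[a ha ea] _ _]] := hedge he.
by exists a => //; apply/(child_onth _ he).
Qed.

Lemma wp_sym u v s : edge u v -> mem s -> reg s rX = edge_at v -> reg s rU = node_at u ->
  wp Wb c_sym 8 s (fun _ s' => frame [:: rB; rI] s s' /\
    exists2 a, onth v (size u) = Some a & reg s' rB = code_pvsym a).
Proof.
move=> he hm hx hu.
have [nu nv _ lt _] := (edge_take _ _ _).1 he.
have stored : size v - size u = 1 \/ good T u /\ good T v -> forall n, 0 < n ->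
    wp Wb (SetReg rB (Get aEdgeSym (Reg rX))) n s (fun _ s' => frame [:: rB; rI] s s' /\
    exists2 a, onth v (size u) = Some a & reg s' rB = code_pvsym a).
  move=> h n n0; have [a ha ea] := edge_sym he h.
  apply: wp_set => //=; first exact: mem_word.
  split; last by exists a => //; rewrite hm // hx.
  by split=> //= r; rewrite !inE negb_or => /andP[/negbTE ->].
have text : size v - size u <> 1 -> direct T u v -> forall n, 4 < n ->
    wp Wb (SetReg rI (Get aEdgeI (Reg rX)) ;; c_text) n s (fun _ s' => frame [:: rB; rI] s s' /\
    exists2 a, onth v (size u) = Some a & reg s' rB = code_pvsym a).
  move=> h1 h2 n n0; have [i [k [ei ek i0 ht]]] := edge_triple he h2 h1.
  have [a ha] := onth_ex lt.
  apply: wp_seq; apply: wp_set => //=; [lia|exact: mem_word|].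
  apply: (wp_call (t := 4)).
  - apply: (@wp_text _ i k a) => //=.
    + by rewrite hm // hx.
    + by rewrite hx.
    + by rewrite -(addn0 i) ht ?addn0 //; lia.
  - by lia.
  move=> n' s' _ [fr hb]; split; last by exists a.
  case: fr => fa fr; split=> // r; rewrite !inE negb_or => /andP[h3 h4].
  by rewrite fr ?inE //= (negbTE h4).
apply: wp_if => //= ; rewrite hm // hx (edge_unit he) => hun.
  by apply: stored => //; left; apply/eqP.
have {}hun : size v - size u <> 1 by apply/eqP.
apply: wp_if => //= ; rewrite hm // hu => hb1.
  by apply: text => //; right=> -[g _]; move/(sl_bad nu): hb1.
apply: wp_if => //= ; rewrite !hm // hx (edge_to he) => hb2.
  by apply: text => //; right=> -[_ g]; move/(sl_bad nv): hb2.
apply: stored => //; right; split; apply: contrapT.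
  by move/(sl_bad nu) => h; rewrite h in hb1.
by move/(sl_bad nv) => h; rewrite h in hb2.
Qed.

Definition nchild := #|{: Sigma + Pi}|.

Lemma edge_PrevSub_rcons u v a : edge u v -> onth v (size u) = Some a -> PrevSub T (rcons u a).
Proof.
move=> he ha; rewrite -(child_take he ha); apply: PrevSub_take.
by case: (edge_PrevSub he).
Qed.

Lemma edges_size u (vs : seq (pvstring Sigma)) : uniq vs ->
  (forall v, v \in vs -> edge u v) -> size vs <= nchild.
Proof.
move=> uv hvs; pose f v := odflt (inr 0 : Sigma + nat) (onth v (size u)).
have fE v : edge u v -> onth v (size u) = Some (f v).
  move=> he; have [_ _ _ lt _] := (edge_take _ _ _).1 he.
  by rewrite /f; have [a ->] := onth_ex lt.
rewrite -(size_map f); apply: (@PrevSub_children _ _ T u).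
  rewrite map_inj_in_uniq // => v v' /hvs e /hvs e' h.
  by apply: (edge_child_uniq e e' (fE _ e)); rewrite h fE.
move=> a /mapP[v /hvs e ->]; exact: edge_PrevSub_rcons (fE _ e).
Qed.

(** Per edge: 8 steps for its first symbol, two tests and two assignments. *)
Definition search_cost := 12 * nchild + 4.

Lemma wp_search u a s : node u -> mem s -> reg s rU = node_at u ->
  reg s rA = code_pvsym a ->
  wp Wb c_search search_cost s (fun _ s' => frame [:: rB; rI; rE; rX] s s' /\
    ((reg s' rX = (-1)%R /\ forall v, edge u v -> onth v (size u) <> Some a) \/
     exists v, [/\ edge u v, onth v (size u) = Some a & reg s' rX = edge_at v])).
Proof.
move=> nu hm hu ha.
have [_ [_ _ _ _ [vs [uv hvs hl]]]] := hnode nu.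
have hsz := edges_size uv (fun v => (hvs v).1).
apply: wp_seq; apply: wp_set => //=; [rewrite /search_cost; lia|exact: mem_word|].
apply: wp_seq; apply: wp_set => //=; [rewrite /search_cost; lia|exact: mem_word|].
pose I n s' := [/\ frame [:: rB; rI; rE; rX] s s', 0 < n &
  (exists vs', [/\ reg s' rE = reg s' rX, edge_list s0 edge_at (reg s' rX) vs',
     12 * size vs' < n, forall v, v \in vs' -> edge u v
     & forall v, edge u v -> onth v (size u) = Some a -> v \in vs']) \/
  (reg s' rE = (-1)%R /\
   exists v, [/\ edge u v, onth v (size u) = Some a & reg s' rX = edge_at v])].
apply: (@wp_while _ I); last first.
  split; [|by rewrite /search_cost; lia|left].
    split=> //= r; rewrite !inE !negb_or => /and4P[_ _ h3 h4].
    by rewrite (negbTE h3) (negbTE h4).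
  exists vs; split=> //=.
  - by rewrite hm // hu.
  - by rewrite /search_cost; lia.
  - by move=> v /hvs.
  - by move=> v /hvs.
move=> n s' [fr n0 H]; split=> //=; case: H => [[vs' [e1 e2 sz h1 h2]]|[e1 h]]; last first.
  rewrite e1 /=; split=> //; by right.
rewrite e1; case: vs' e2 sz h1 h2 => [|v vs'] /= e2 sz h1 h2.
  rewrite e2 /=; split=> //; left; split=> // v he hv.
  by have := h2 v he hv.
case: e2 => ev e2.
have he : edge u v by apply: h1; rewrite mem_head.
have [x0 _] := hedge he.
rewrite ev ifT; last by lia.
have hm' := mem_frame hm fr.
apply: wp_seq; apply: (wp_call (t := 8)).
- apply: (wp_sym he) => //; by case: fr => _ ->.
- by lia.
move=> n1 s1 hn1 [[fa1 fr1] [b hb eb]].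
have fr' : frame [:: rB; rI; rE; rX] s s1.
  case: fr => fa fr; split; first by rewrite fa1 fa.
  move=> r hr; rewrite fr1 ?fr //; apply: contra hr; rewrite !inE.
  by case/orP=> ->; rewrite ?orbT.
have hm1 := mem_frame hm fr'.
apply: wp_if => /=; first by lia.
  rewrite eb (fr'.2 rA) // ha (inj_eq (@code_pvsym_inj _)) => /eqP eab; subst b.
  apply: wp_set => //=; [lia|inword|].
  split; last 1 first.
  - right; split=> //; exists v; split=> //=.
    by rewrite -ev fr1.
  - case: fr' => fa' fr'; split=> // r hr; rewrite /= ifF ?fr' //.
    by apply: negbTE; apply: contra hr => /eqP ->.
  - by lia.
rewrite eb (fr'.2 rA) // ha (inj_eq (@code_pvsym_inj _)) => /eqP nab.
apply: wp_seq; apply: wp_set => //=; [lia|exact: mem_word|].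
apply: wp_set => //=; [lia|exact: mem_word|].
split.
- case: fr' => fa' fr'; split=> // r hr; rewrite /= ifF ?ifF ?fr' //;
  by apply: negbTE; apply: contra hr => /eqP ->.
- by lia.
left; exists vs'; split=> //=.
- by rewrite hm1 // fr1 // ev -hm'.
- by lia.
- by move=> v' hv'; apply: h1; rewrite inE hv' orbT.
move=> v' he' hv'; have := h2 v' he' hv'; rewrite inE => /orP[/eqP e|//].
by case: nab; move: hb; rewrite -e hv' => -[].
Qed.

Variable X : pvstring Sigma.
Hypotheses (vX : valid X) (hXW : size X <= W).
Local Notation m := (size X).
Local Notation ok := (@ok Sigma Pi T X).

Definition pre_mem s := forall i x, onth X i = Some x ->
  arr s aPre (Posz i.+1) = code_pvsym x.
Definition mk_mem mk s := forall i, i < m ->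
  arr s aMk (Posz i.+1) = Posz (mk i) /\ mk i <= m.

Lemma wp_check p a c mk s : onth X p = Some a -> reg s rP = Posz p ->
  reg s rB = code_pvsym c -> pre_mem s -> mk_mem mk s ->
  wp Wb c_check 7 s (fun _ s' =>
    if a == expected mk p c then frame [:: rB; rP] s s' /\ reg s' rP = Posz p.+1
    else frame [:: rB; rOut; rGo; rEnd] s s' /\
      [/\ reg s' rOut = 0%R, reg s' rGo = 0%R & reg s' rEnd = 0%R]).
Proof.
move=> ha hp hb hpre hmk; have hpm := onth_size ha.
have ep : (Posz p + 1 = Posz p.+1)%R by lia.
apply: wp_seq; apply: (wp_call (t := 2)
  (P := fun s' => frame [:: rB] s s' /\ reg s' rB = code_pvsym (expected mk p c))) => //.
  apply: wp_if => //=; rewrite hb code_pvsym0 => hc.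
    have [h1 h2] := hmk p hpm.
    apply: wp_set => //=; rewrite hp ep h1; first by inword.
    split; first by split=> //= r; rewrite inE => /negbTE ->.
    by rewrite (eqP hc).
  apply: wp_skip => //; split=> //; rewrite hb.
  by case: (c) hc => [|[]].
move=> n' s1 hn' [[fa fr] hb1].
have hp1 : reg s1 rP = Posz p by rewrite fr.
apply: wp_if => /=; first by lia.
  rewrite hp1 hb1 ep fa (hpre _ _ ha) (inj_eq (@code_pvsym_inj _)) eq_sym => e.
  apply: wp_set => /=; [by lia|by rewrite hp1; inword|rewrite e].
  split; last by rewrite hp1 ep.
  split; first exact: fa.
  by move=> r; rewrite !inE negb_or /= => /andP[h1 /negbTE ->]; rewrite fr ?inE.
rewrite hp1 hb1 ep fa (hpre _ _ ha) (inj_eq (@code_pvsym_inj _)) eq_sym => /negbTE e.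
apply: wp_seq; apply: wp_set => /=; [by lia|by inword|].
apply: wp_seq; apply: wp_set => /=; [by lia|by inword|].
apply: wp_set => /=; [by lia|by inword|rewrite e].
split=> //; split; first exact: fa.
move=> r; rewrite !inE !negb_or /= => /and4P[h1 /negbTE h2 /negbTE h3 /negbTE h4].
by rewrite h2 h3 h4 fr ?inE.
Qed.

Variable M : nat.
Hypotheses (hM : forall i, i <= m -> ok i <-> i <= M) (hMm : M <= m).

(** The walk stops at the first mismatch, at index [M], so rounds are counted only up to
    [minn q M.+1]; 15 bounds one round. *)
Lemma wp_leaf u v lv p q mk n0 s : edge u v -> direct T u v -> size v - size u <> 1 ->
  mem s -> pre_mem s -> mk_mem mk s ->
  reg s rX = edge_at v -> reg s rP = Posz p -> reg s rEnd = Posz q ->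
  size u = p - lv -> lv <= p < q -> q <= m -> q <= size v + lv -> ok p -> 
  (forall i a, p <= i < q -> ok i -> onth v (i - lv) = Some a ->
     ok i.+1 <-> onth X i = Some (expected mk i a)) ->
  wp Wb c_leaf (n0 + 2 + 15 * (minn q M.+1 - p)) s (fun n' s' => n0 <= n' /\
    ((ok q /\ frame [:: rB; rI; rP] s s' /\ reg s' rP = Posz q) \/
     (~ ok q /\ frame [:: rB; rI; rP; rOut; rGo; rEnd] s s' /\
      reg s' rOut = 0%R /\ reg s' rGo = 0%R))).
Proof.
move=> he hd h1 hm hpre hmk hx hp hend su hpq qm qv okp hck.
have [i0 [k [ei ek i00 ht]]] := edge_triple he hd h1.
have i0W : i0 <= W by have := get_word aEdgeI (edge_at v); rewrite ei; lia.
apply: wp_seq; apply: wp_set => //=; [lia|exact: mem_word|].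
rewrite hm // hx ei.
pose I n s' := (exists i, [/\ p <= i <= q, ok i, frame [:: rB; rI; rP] s s',
   reg s' rP = Posz i /\ reg s' rI = Posz (i0 + (i - p))
   & n0 + 1 + 15 * (minn q M.+1 - i) <= n]) \/
  [/\ ~ ok q, frame [:: rB; rI; rP; rOut; rGo; rEnd] s s',
   [/\ reg s' rOut = 0%R, reg s' rGo = 0%R & reg s' rEnd = 0%R],
   (0 <= reg s' rP)%R & n0 < n].
apply: (@wp_while _ I); last first.
  left; exists p; split=> //=; [lia| |by split=> //; congr Posz; lia|lia].
  by split=> //= r; rewrite !inE !negb_or => /and3P[_ /negbTE -> _].
move=> n s' [[i [hi oi fr [hpi hii] hn]]|[nq fr [e1 e2 e3] hp0 hn]]; last first.
  split; first by lia.
  rewrite /= e3 ifF; last by lia.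
  split; [by lia|by right].
split; first by lia.
rewrite /= hpi (fr.2 rEnd) // hend.
case: (ltnP i q) => hiq; last first.
  have ? : i = q by lia.
  subst i; rewrite ifF; last by lia.
  split; [by lia|by left].
rewrite ifT; last by lia.
have iM : i <= M by apply/hM => //; lia.
have [a ha] := @onth_ex _ v (i - lv) ltac:(lia).
have [b hb] := @onth_ex _ X i ltac:(lia).
have hm' := mem_frame hm fr.
apply: wp_seq; apply: (wp_call (t := 4)).
- apply: (@wp_text _ (i0 + (i - p)) k a) => //; first by lia.
  + by rewrite (fr.2 rX) // hx.
  + by rewrite ht; [rewrite -ha; congr onth; lia|lia].
- by lia.
move=> n1 s1 hn1 [fr1 hb1].
apply: wp_seq; apply: wp_set => /=.
- by lia.
- by rewrite (fr1.2 rI) // hii; inword.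
set s2 := set_reg _ _ _.
have fr2 : frame [:: rB; rI; rP] s s2.
  split; first by rewrite /= fr1.1 fr.1.
  move=> r hr; have := hr; rewrite !inE !negb_or => /and3P[r1 /negbTE r2 r3] /=.
  by rewrite r2 fr1.2 ?inE // fr.2.
have hp2 : reg s2 rP = Posz i by rewrite /= fr1.2.
have hi2 : reg s2 rI = Posz (i0 + (i.+1 - p)) by rewrite /= fr1.2 // hii; lia.
apply: (wp_call (t := 7)).
- apply: (@wp_check i b a mk s2) => //.
  + by move=> j x hj; rewrite fr2.1; apply: hpre.
  + by move=> j hj; rewrite fr2.1; apply: hmk.
- by lia.
have hc := hck i a ltac:(lia) oi ha.
move=> n3 s3 hn3; case: eqP => [e|ne] [fr3 h3].
  left; exists i.+1; split=> //.
  - by lia.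
  - by apply/hc; rewrite hb e.
  - split; first by rewrite fr3.1 fr2.1.
    move=> r hr; have := hr; rewrite !inE !negb_or => /and3P[r1 r2 r3] /=.
    by rewrite fr3.2 ?inE ?negb_or ?r1 ?r3 // fr2.2.
  - by rewrite h3 fr3.2 // hi2.
  - by lia.
right; case: h3 => e1 e2 e3; split=> //.
- move=> oq; have : ok i.+1 by apply: ok_le oq.
  by rewrite hc hb; case.
- split; first by rewrite fr3.1 fr2.1.
  move=> r; rewrite !inE !negb_or => /and5P[r1 r2 r3 r4 /andP[r5 r6]].
  by rewrite fr3.2 ?fr2.2 // !inE !negb_or ?r1 ?r2 ?r3 ?r4 ?r5 ?r6.
- by rewrite fr3.2 // hp2.
- by lia.
Qed.

(** * The machine invariant and its budget *)

Local Notation lev := (@level Sigma X).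

(* A suspended task: at level [f_s], the edge to [f_v] is being verified on the
   way to position [f_q]. *)
Record task := Task { f_s : nat; f_p0 : nat; f_q : nat; f_v : pvstring Sigma }.

Fixpoint stk_mem (s : state) (st : seq task) : Prop :=
  if st is f :: st' then
    [/\ arr s aStS (Posz (size st')) = Posz (f_s f),
        arr s aStU (Posz (size st')) = node_at (f_v f),
        arr s aStQ (Posz (size st')) = Posz (f_q f),
        in_word Wb (node_at (f_v f)) & stk_mem s st']
  else True.

(** [q] is where the top task resumes, and its context is stated for that position. If its edge runs
    past [f_q], then [q] is [f_q] and another pop follows at once; hence the node is required only
    at the end of the edge. *)
Fixpoint stk_ok (mk : nat -> nat) (lv q : nat) (st : seq task) : Prop :=
  if st is f :: st' then
    [/\ f_s f < lv, f_s f <= f_p0 f <= q,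
        ctx T X (0 < size st') mk (f_s f) (f_p0 f) (f_q f) q,
        [/\ q = minn (f_q f) (size (f_v f) + f_s f), f_q f <= m, node (f_v f)
           & ok q -> q = size (f_v f) + f_s f -> lev (f_s f) q = f_v f]
      & stk_ok mk (f_s f) (f_q f) st']
  else True.

Lemma stk_ok_mono mk mk' lv q st : stk_ok mk lv q st ->
  (forall i, q <= i -> mk' i = mk i) -> stk_ok mk' lv q st.
Proof.
elim: st lv q => [//|f st IH] lv q [h1 h2 h3 [h4 h5 h6 h7] h8] hm; split=> //.
  exact: ctx_mono h3 (leqnn _) hm.
by apply: IH h8 _ => i hi; apply: hm; lia.
Qed.

Lemma stk_mem_eq s s' st : (forall a i, aStS <= a -> (i < Posz (size st))%R ->
  arr s' a i = arr s a i) -> stk_mem s st -> stk_mem s' st.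
Proof.
elim: st => //= f st IH h [h1 h2 h3 h4 h5].
rewrite !h //; try lia; split=> //.
by apply: IH h5 => a i ha hi; apply: h => //; lia.
Qed.

(** Levels increase strictly along the stack. This keeps stack addresses within a machine word. *)
Lemma stk_size mk lv q st : stk_ok mk lv q st -> size st <= lv.
Proof.
elim: st lv q => [//|f st IH] lv q [h1 _ _ _ /IH h] /=; lia.
Qed.

(** Bounds one round of the main loop, apart from the walk along a stored label. *)
Definition body_cost := search_cost + 80.
Lemma body_cost_ge : 80 <= body_cost. Proof. exact: leq_addl. Qed.

(** A symbol can pay for its round, for a debt of two rounds, and for its step in [c_leaf]. A push
    pays for its own round and for the round of its pop. *)
Definition PhiX := Phi T X (3 * body_cost + 20) (2 * body_cost) M.

Fixpoint stkpot (q : nat) (st : seq task) : nat :=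
  if st is f :: st' then PhiX (f_s f) q (f_q f) + stkpot (f_q f) st' else 0.

(* [debt] records that a push has not yet been paid for; this is allowed only
   when the next edge is direct, so that the coming comparison pays. *)
Record running n s mk lv p0 p q st (debt : bool) : Prop := Running {
  r_mem : mem s;
  r_pre : pre_mem s;
  r_mk : mk_mem mk s;
  r_stk : stk_mem s st;
  r_go : reg s rGo = 1%R;
  r_lv : reg s rS = Posz lv;
  r_q : reg s rQ = Posz q;
  r_d : reg s rD = Posz (size st);
  r_p : reg s rP = Posz p;
  r_le : lv <= p0 <= p;
  r_pq : p <= q <= m;
  r_ok : ok p;
  r_ctx : ctx T X (0 < size st) mk lv p0 q p;
  r_u : p < q -> node (lev lv p) /\ reg s rU = node_at (lev lv p);
  r_stk_ok : stk_ok mk lv q st;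
  r_debt : debt -> p < q /\ forall v', edge (lev lv p) v' ->
     onth v' (p - lv) = onth (iter lv sl X) (p - lv) -> direct T (lev lv p) v';
  r_n : PhiX lv p q + stkpot q st + body_cost * (size st).+1 <= n + debt * (2 * body_cost)
}.

Definition main_inv n s :=
  (exists mk lv p0 p q st debt, running n s mk lv p0 p q st debt) \/
  [/\ reg s rGo = 0%R, 0 < n & reg s rOut = 1%R <-> ok m].

Lemma Phi_min s p q : p <= M -> p < q <= m ->
  (3 * body_cost + 20) * (minn q M.+1 - p) <= PhiX s p q.
Proof.
move=> hp hq; rewrite /PhiX (@Phi_cat _ _ T X _ _ M s p (minn q M.+1) q); last by lia.
by apply: leq_trans (leq_addr _ _); apply: Phi_ge => //; lia.
Qed.

Lemma okM p : p <= m -> ok p -> p <= M.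
Proof. by move=> h /hM; apply. Qed.

(** A debt is two rounds, and it is allowed only in front of a symbol that is worth more than
    three. *)
Lemma running_n n s mk lv p0 p q st debt : running n s mk lv p0 p q st debt ->
  body_cost <= n.
Proof.
move=> r; have := r_n r; have := r_debt r; have := r_pq r; have := @okM p _ (r_ok r).
case: debt {r} => /= hp hpq; last by rewrite mulnSr; lia.
move=> /(_ isT)[lt _]; have := @Phi_min lv p q (hp ltac:(lia)) ltac:(lia).
have : 1 <= minn q M.+1 - p by have := hp ltac:(lia); lia.
move: (minn q M.+1 - p) => x hx; rewrite mulnSr; nia.
Qed.

Lemma wp_pop n s mk lv p0 p st debt : running n s mk lv p0 p p st debt ->
  wp Wb c_pop (n - 2) s main_inv.
Proof.
move=> r; have n1 := running_n r; rewrite /body_cost in n1.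
have d0 : debt = false.
  by have := r_debt r; case: (debt) => // /(_ isT)[]; rewrite ltnn.
have hn := r_n r; rewrite d0 /= addn0 (_ : PhiX lv p p = 0) ?add0n in hn; last by rewrite /PhiX Phi_nil.
have hpm : p <= m by have := r_pq r; lia.
apply: wp_if => /=; first by lia.
  rewrite (r_d r) => /eqP[] h; have st0 : st = [::] by apply: size0nil; lia.
  have := r_ctx r; rewrite st0 /= => -[_ pm _].
  apply: wp_seq; apply: wp_set => /=; [by lia|by inword|].
  apply: wp_set => /=; [by lia|by inword|].
  by right; split=> //=; [lia|rewrite -pm; split=> // _; apply: r_ok r].
rewrite (r_d r) => h; case: st r h hn => [//|f st] r _ hn.
have [m1 m2 m3 m4 m5] := r_stk r; have [s1 s2 s3 [s4 s5 s6 s7] s8] := r_stk_ok r.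
have hst := stk_size (r_stk_ok r); have hle := r_le r; simpl in hst.
have es : (Posz (size st).+1 - 1 = Posz (size st))%R by lia.
apply: wp_seq; apply: wp_set => /=; rewrite ?(r_d r) /= ?es; [by lia|by inword|].
apply: wp_seq; apply: wp_set => /=; rewrite ?m1; [by lia|by inword|].
apply: wp_seq; apply: wp_set => /=; rewrite ?m2; [by lia|by []|].
apply: wp_set => /=; rewrite ?m3; [by lia|by inword|].
left; exists mk, (f_s f), (f_p0 f), p, (f_q f), st, false; split=> //=.
- exact: r_mem r.
- exact: r_pre r.
- exact: r_mk r.
- exact: stk_mem_eq m5.
- exact: r_go r.
- exact: r_p r.
- by lia.
- exact: r_ok r.
- move=> lt; have -> : lev (f_s f) p = f_v f; last by [].
  by apply: s7; [apply: r_ok r|lia].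
- by move: hn; rewrite /= !mulnS; have := body_cost_ge; lia.
Qed.

Lemma running_frame n s s' rs mk lv p0 p q st debt :
  running n s mk lv p0 p q st debt -> frame rs s s' ->
  all (fun r => (r < 3) || (8 < r)) rs -> running n s' mk lv p0 p q st debt.
Proof.
move=> r fr /allP hrs; have hr k : 3 <= k <= 8 -> reg s' k = reg s k.
  move=> hk; apply: fr.2; apply/negP => /hrs; lia.
case: r => h1 h2 h3 h4 h5 h6 h7 h8 h9 h10 h11 h12 h13 h14 h15 h16 h17.
split; rewrite ?hr //.
- exact: mem_frame h1 fr.
- by move=> i x hx; rewrite fr.1; apply: h2.
- by move=> i hi; rewrite fr.1; apply: h3.
- by apply: stk_mem_eq h4 => a i _ _; rewrite fr.1.
Qed.

(** * One round at the selected edge *)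

Section Edge.
Variables (N : nat) (s : state) (mk : nat -> nat) (lv p0 p q : nat) (st : seq task).
Variables (debt : bool) (v Y : pvstring Sigma).
Let u := lev lv p.
Let q' := minn q (size v + lv).
Hypotheses (hr : running N s mk lv p0 p q st debt) (hpq : p < q) (he : edge u v).
Hypotheses (hv : onth v (p - lv) = onth (iter lv sl X) (p - lv)).
Hypotheses (hx : reg s rX = edge_at v) (hs : sel T X mk lv p q' v Y).

Let hle := r_le hr.
Let hqm : q <= m. Proof. by have := r_pq hr; lia. Qed.
Let hsz : size u = p - lv. Proof. by rewrite size_lev //; lia. Qed.
Let hlt : p - lv < size v.
Proof. by have [_ _ _ + _] := (edge_take _ _ _).1 he; rewrite hsz. Qed.
Let pM : p <= M. Proof. by apply: okM (r_ok hr); lia. Qed.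

(** Moving on by at least one symbol releases enough for this round, for the label walk and for an
    open debt, which is thereby cleared. *)
Lemma running_advance s' n' :
  mem s' -> pre_mem s' -> mk_mem mk s' -> stk_mem s' st -> reg s' rGo = 1%R ->
  reg s' rS = Posz lv -> reg s' rQ = Posz q -> reg s' rD = Posz (size st) ->
  reg s' rP = Posz q' -> reg s' rU = node_at v -> ok q' ->
  N <= n' + body_cost + 15 * (minn q' M.+1 - p) ->
  running n' s' mk lv p0 q' q st false.
Proof.
move=> h1 h2 h3 h4 h5 h6 h7 h8 h9 h10 oq hn; split=> //.
- by lia.
- by lia.
- by apply: ctx_mono (r_ctx hr) _ _ => //; lia.
- move=> lt; have -> : lev lv q' = v; last by split=> //; have [] := (edge_take _ _ _).1 he.
  by apply: (sel_end_node hs) => //; lia.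
- exact: r_stk_ok hr.
have := r_n hr; rewrite /= addn0.
rewrite {1}/PhiX (@Phi_cat _ _ T X _ _ M lv p q' q) -/PhiX; last by lia.
have := @Phi_min lv p q' pM ltac:(lia).
have : 1 <= minn q' M.+1 - p by lia.
move: hn; move: (minn q' M.+1 - p) => x hn x1 hp hN.
have : debt * (2 * body_cost) <= 2 * body_cost by case: (debt); lia.
have : 3 * body_cost + 15 * x <= (3 * body_cost + 20) * x.
  by rewrite mulnDl leq_add ?leq_pmulr ?leq_mul.
lia.
Qed.

Lemma wp_mark s1 : frame [:: rV] s s1 -> reg s1 rV = node_at v -> reg s1 rEnd = Posz q' ->
  wp Wb c_mark 4 s1 (fun _ s' => [/\ forall r, r != rR -> reg s' r = reg s1 r,
    forall a i, a != aMk -> arr s' a i = arr s1 a i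
    & mk_mem (mark lv p q' u v mk) s']).
Proof.
move=> fr hV hE; have hr1 := running_frame hr fr isT; have hm := r_mem hr1.
have [_ nv _ _ _] := (edge_take _ _ _).1 he.
have [_ [_ hRe _ _ _]] := hnode nv; have {}hRe := hRe _ he.
have hmk := r_mk hr1.
have nomark : ~~ ((0 < Defs.Re u v) && (p + Defs.Re u v <= q')) ->
    mk_mem (mark lv p q' u v mk) s1.
  move=> h i hi; rewrite /mark ifF; first exact: hmk.
  by apply: contraNF h => /and3P[-> _ ->].
have rW := get_word aNodeRe (node_at v); rewrite hRe in rW.
apply: wp_seq; apply: wp_set => //=; first exact: mem_word.
rewrite hm // hV hRe.
have reg1 r : r != 15 -> (if r == 15 then Posz (Defs.Re u v) else reg s1 r) = reg s1 r.
  by move=> /negbTE ->.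
apply: wp_if => //= h1; last first.
  apply: wp_skip => //=; split=> //=.
  by apply: nomark; lia.
apply: wp_if => //=; rewrite hE (r_p hr1) => h2.
  apply: wp_skip => //=; split=> //=.
  by apply: nomark; lia.
apply: wp_put => //=; rewrite ?(r_p hr1) ?(r_lv hr1).
- by inword.
- by inword.
split=> //=.
  by move=> a i /negbTE ->.
move=> i hi; rewrite /= /mark.
have -> : (Posz i.+1 == Posz p + Posz (Defs.Re u v))%R = (i.+1 == p + Defs.Re u v) by lia.
case: eqP => e /=; last by rewrite andbF; apply: hmk.
by rewrite !ifT; lia.
Qed.

Lemma wp_push n : ~ direct T u v -> reg s rEnd = Posz q' ->
  N <= n + search_cost + 30 -> wp Wb c_push n s main_inv.
Proof.
move=> nd hE hN.
have hn : N <= n + body_cost - 50 by rewrite /body_cost; lia.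
have h1 : size v - size u <> 1 by move=> h; apply: nd; left.
have hg : good T u /\ good T v by apply: contrapT => h; apply: nd; right.
have [_ [_ _ _ _ /(_ h1 hg)[w hfl eFL]]] := hedge he.
have [k spec] := fast_linkP he hg.1 hfl.
have [k0 ku ew nw _ _ _] := spec; rewrite hsz in ku.
have klv : lv + k <= p by lia.
have ew' : w = lev (lv + k) p by rewrite ew /u /level -iterD addnC.
have szw : size w = p - (lv + k) by rewrite ew' size_lev //; lia.
have [_ [lenw _ _ _ _]] := hnode nw.
have [nu nv _ _ _] := (edge_take _ _ _).1 he.
have [_ [lenu _ _ _ _]] := hnode nu.
(* A debt would make this edge direct, so an unpaid push is never followed immediately by another
   push. *)
have d0 : debt = false.
  have := r_debt hr; case: (debt) => // /(_ isT)[_ /(_ v he hv)]; exact: (fun h => False_ind _ (nd h)).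
have hNc1 := running_n hr; have c1g := body_cost_ge.
have hm := r_mem hr; have hst := stk_size (r_stk_ok hr).
have wv : in_word Wb (node_at v) by rewrite -(edge_to he) -hm //; exact: mem_word.
have eV : arr s aEdgeTo (reg s rX) = node_at v by rewrite hm // hx (edge_to he).
apply: wp_seq; apply: wp_set => /=; rewrite ?eV //; first by lia.
set s1 := set_reg _ _ _.
have fr1 : frame [:: rV] s s1 by split=> //= r; rewrite inE => /negbTE ->.
apply: wp_seq; apply: (wp_call (wp_mark fr1 _ _)) => //; first by lia.
move=> n2 s2 hn2 [hr2 ha2 hmk2].
have e r : r != 13 -> r != 15 -> reg s2 r = reg s r.
  by move=> /negbTE r1 r2; rewrite hr2 //= r1.
have eV2 : reg s2 13 = node_at v by rewrite hr2.
have eD := r_d hr; have eS := r_lv hr; have eQ := r_q hr.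
apply: wp_seq; apply: wp_put => /=; rewrite ?e ?eD ?eS //; [by lia|by inword|by inword|].
apply: wp_seq; apply: wp_put => /=; rewrite ?eV2 ?e ?eD //; [by lia|by inword|].
apply: wp_seq; apply: wp_put => /=; rewrite ?e ?eD ?eQ //; [by lia|by inword|by inword|].
apply: wp_seq; apply: wp_set => /=; rewrite ?e ?eD //; [by lia|by inword|].
apply: wp_seq; apply: wp_set => /=; rewrite ?e ?hE //; [by lia|by inword|].
have eW : arr s2 aEdgeFL (reg s rX) = node_at w by rewrite ha2 //= hm // hx.
have ww : in_word Wb (node_at w) by rewrite -eFL; have ? := get_word aEdgeFL (edge_at v); inword.
apply: wp_seq; apply: wp_set => /=; rewrite ?e ?eW //; first by lia.
have eL1 : arr s2 aNodeLen (node_at u) = Posz (size u) by rewrite ha2 //= hm.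
have eL2 : arr s2 aNodeLen (node_at w) = Posz (size w) by rewrite ha2 //= hm.
have [_ eU] := r_u hr hpq.
have eSk : (Posz lv + (Posz (size u) - Posz (size w)) = Posz (lv + k))%R.
  by rewrite hsz szw; lia.
apply: wp_seq; apply: wp_set => /=; rewrite ?e ?eS ?eU ?eL1 ?eL2 ?eSk //; [by lia|by inword|].
apply: wp_set => /=; rewrite //; first by lia.
have hp' : p < q' <= m by lia.
have drop := push_drop vX hM hMm hs ltac:(lia) ltac:(lia) ltac:(lia) he spec klv pM.
(* The push stays unpaid exactly when no index of the task loses a charge; [push_drop] then makes
   the next edge direct. *)
pose debt' := ~~ `[< exists i, [/\ p <= i < q', i < minn m M.+1
                   & psi T X M (lv + k) i < psi T X M lv i] >].
left; exists (mark lv p q' u v mk), (lv + k), p, p, q', (Task lv p0 q v :: st), debt'.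
split=> //=; rewrite ?e //.
- move=> a i ha /=; have hk k1 : 14 <= k1 -> (a == k1) = false by lia.
  by rewrite !hk //= ha2 ?hk // hm.
- by move=> i x hX /=; rewrite ha2 //; apply: (r_pre hr).
- split=> //=; rewrite ?eqxx //.
  apply: stk_mem_eq (r_stk hr) => a i ha hi /=.
  have /negbTE -> : i != Posz (size st) by lia.
  by rewrite !andbF ha2 //; lia.
- exact: r_go hr.
- by congr Posz; lia.
- exact: r_p hr.
- by lia.
- by lia.
- exact: r_ok hr.
- by apply: (push_ctx hs _ _ _ he hv spec); lia.
- by move=> _; rewrite -ew'.
- split=> //=; first by lia.
  + by lia.
  + apply: ctx_mono (r_ctx hr) _ _; first by lia.
    by move=> i hi; rewrite /mark ifF //; lia.
  + split=> //.
    by move=> oq eq; apply: (sel_end_node hs) => //; lia.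
  apply: stk_ok_mono (r_stk_ok hr) _ => i hi.
  by rewrite /mark ifF //; lia.
- move=> /asboolP hd; split; first by lia.
  by rewrite -ew'; case: drop.
have := r_n hr; rewrite d0 /= addn0 !mulnS => hb.
rewrite {1}/PhiX (@Phi_cat _ _ T X _ _ M lv p q' q) -/PhiX in hb; last by lia.
case: (boolP debt') => hd.
  have := @Phi_le _ _ T X (3 * body_cost + 20) (2 * body_cost) M hMm lv (lv + k) p q' (leq_addr _ _).
  by rewrite -/PhiX => hP; clear -hP hb hn hn2 c1g; lia.
move: hd; rewrite negbK => /asboolP[i [i1 i2 i3]].
have := @Phi_lt _ _ T X (3 * body_cost + 20) (2 * body_cost) M hMm lv (lv + k) p q' i (leq_addr _ _) i1 i2 i3.
by rewrite -/PhiX => hP; clear -hP hb hn hn2 c1g; lia.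
Qed.

Lemma rejected n' s' : ~ ok q' -> reg s' rOut = 0%R -> reg s' rGo = 0%R -> 0 < n' ->
  main_inv n' s'.
Proof.
move=> nq h1 h2 n0; right; split=> //; rewrite h1; split=> // om.
by case: nq; apply: ok_le om; lia.
Qed.

Lemma wp_leaf_step n : direct T u v -> size v - size u <> 1 -> reg s rEnd = Posz q' ->
  N <= n + search_cost + 30 ->
  wp Wb (c_leaf ;; SetReg rU (Get aEdgeTo (Reg rX))) n s main_inv.
Proof.
move=> hd h1 hE hN; have hm := r_mem hr.
pose D := minn q' M.+1 - p; pose n0 := n - 2 - 15 * D.
have hn0 : N <= n0 + body_cost + 15 * D - 2 /\ 2 <= n0.
  have := r_n hr; have := @Phi_min lv p q pM ltac:(lia).
  have hx1 : 1 <= D by rewrite /D; lia.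
  have : D <= minn q M.+1 - p by rewrite /D; lia.
  move: (minn q M.+1 - p) => x hD1 hP hNn.
  have hD : 0 < x by lia.
  have : debt * (2 * body_cost) <= 2 * body_cost by case: (debt); lia.
  have h3 : 3 * body_cost <= 3 * body_cost * x by rewrite leq_pmulr.
  by rewrite mulnDl in hP; rewrite /n0 /D /body_cost in hD hD1 hx1 hNn h3 hP *; lia.
have en : n = n0 + 2 + 15 * D by rewrite /n0; lia.
have check : forall i a, p <= i < q' -> ok i -> onth v (i - lv) = Some a ->
     ok i.+1 <-> onth X i = Some (expected mk i a).
  by move=> i a hi oi ha; apply: (sel_check hs) => //; lia.
apply: wp_seq; rewrite en; apply: wp_weaken.
  apply: (wp_leaf n0 he hd h1 hm (r_pre hr) (r_mk hr) hx (r_p hr) hE hsz _ _ _ (r_ok hr) check); lia.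
move=> n' s' [hn' H]; apply: wp_set => /=; first by lia.
  have [fr _] : arr s' = arr s /\ True by case: H => -[_ [[-> _] _]].
  by rewrite fr; apply: mem_word.
case: H => [[oq [fr hp]]|[nq [fr [ho hg]]]]; last by apply: rejected => //=; lia.
left; exists mk, lv, p0, q', q, st, false.
have eU : reg s' rX = edge_at v by rewrite fr.2.
apply: running_advance => //=; rewrite ?fr.1 ?(fr.2 rGo) ?(fr.2 rS) ?(fr.2 rQ) ?(fr.2 rD) //.
- by move=> a i ha /=; rewrite fr.1 hm.
- by move=> i x hX /=; rewrite fr.1; apply: (r_pre hr).
- by move=> i hi /=; rewrite fr.1; apply: (r_mk hr).
- by apply: stk_mem_eq (r_stk hr) => a i _ _ /=; rewrite fr.1.
- exact: r_go hr.
- exact: r_lv hr.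
- exact: r_q hr.
- exact: r_d hr.
- by rewrite hm // eU (edge_to he).
- by move: hn0; rewrite /D; lia.
Qed.

(** The search matched the letter only as it appears at level [lv]; a 0 must still be compared with
    the pattern through its mark. *)
Lemma wp_unit_step n a : size v - size u = 1 -> reg s rA = code_pvsym a ->
  onth v (p - lv) = Some a -> N <= n + search_cost + 30 ->
  wp Wb (SetReg rB (Reg rA) ;; c_check ;; SetReg rU (Get aEdgeTo (Reg rX))) n s main_inv.
Proof.
move=> h1 hA ha hN; have hm := r_mem hr; have hNc1 := running_n hr; rewrite /body_cost in hNc1.
have eq' : q' = p.+1 by move: h1; rewrite /q' hsz; lia.
have [b hb] := @onth_ex _ X p ltac:(lia).
have check := sel_check hs (i := p) (a := a) ltac:(lia) ltac:(lia) ltac:(lia) ltac:(lia) (r_ok hr) ha.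
apply: wp_seq; apply: wp_set => /=; rewrite ?hA; first by lia.
  have aw : code_pvsym a = arr s0 aEdgeSym (edge_at v).
    have [|a' ha' ->] := edge_sym he; first by left.
    by move: ha'; rewrite hsz ha => -[->].
  by rewrite aw; have ? := get_word aEdgeSym (edge_at v); inword.
apply: wp_seq; apply: (wp_call (wp_check hb _ _ _ _)).
- exact: (r_p hr).
- by [].
- exact: (r_pre hr).
- exact: (r_mk hr).
- by lia.
move=> n1 s1 hn1 H; apply: wp_set => /=; first by lia.
  have fr : arr s1 = arr s by move: H; case: ifP => _ [[->]].
  by rewrite fr; apply: mem_word.
case: eqP H => [e|ne] [fr H]; last first.
  case: H => ho hg _; apply: rejected => //=; last by lia.
  by rewrite eq' check hb; case.
left; exists mk, lv, p0, q', q, st, false.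
have eU : reg s1 rX = edge_at v by rewrite fr.2.
apply: running_advance => //=; rewrite ?fr.1 ?(fr.2 rGo) ?(fr.2 rS) ?(fr.2 rQ) ?(fr.2 rD) //.
- by move=> c i hc /=; rewrite fr.1 /= hm.
- by move=> i x hX /=; rewrite fr.1; apply: (r_pre hr).
- by move=> i hi /=; rewrite fr.1; apply: (r_mk hr).
- by apply: stk_mem_eq (r_stk hr) => c i _ _ /=; rewrite fr.1.
- exact: r_go hr.
- exact: r_lv hr.
- exact: r_q hr.
- exact: r_d hr.
- by rewrite H eq'.
- by rewrite hm // eU (edge_to he).
- by rewrite eq' check hb e.
- by rewrite /body_cost; lia.
Qed.

End Edge.

Lemma wp_edge N s mk lv p0 p q st debt v a n :
  running N s mk lv p0 p q st debt -> p < q -> edge (lev lv p) v ->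
  onth (iter lv sl X) (p - lv) = Some a -> onth v (p - lv) = Some a ->
  reg s rX = edge_at v -> reg s rA = code_pvsym a ->
  N <= n + search_cost + 20 -> wp Wb c_edge n s main_inv.
Proof.
move=> hr hpq he hXa hva hx hA hN; have hm := r_mem hr.
have hNc1 := running_n hr; rewrite /body_cost in hNc1.
have hv : onth v (p - lv) = onth (iter lv sl X) (p - lv) by rewrite hva.
have hle := r_le hr; have hqm := r_pq hr.
have [Y hs] := select (r_ctx hr) hle ltac:(lia) (r_ok hr) he hv.
have [nu nv _ _ _] := (edge_take _ _ _).1 he.
have [_ [lenv _ _ _ _]] := hnode nv.
have svW : size v <= W by have := get_word aNodeLen (node_at v); rewrite lenv; lia.
have [_ eU] := r_u hr hpq.
apply: wp_seq; apply: (wp_call (t := 3)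
  (P := fun s' => frame [:: rEnd] s s' /\ reg s' rEnd = Posz (minn q (size v + lv)))).
- have el : (arr s aNodeLen (arr s aEdgeTo (reg s 11)) = Posz (size v))%R.
    by rewrite !hm // hx (edge_to he).
  apply: wp_seq; apply: wp_set => //=; rewrite el (r_lv hr); first by inword.
  apply: wp_if => //=; rewrite (r_q hr) => h.
    apply: wp_set => //=; rewrite (r_q hr); first by inword.
    split; last by congr Posz; lia.
    by split=> //= r; rewrite inE => /negbTE ->.
  apply: wp_skip => //; split; last by rewrite /=; congr Posz; lia.
  by split=> //= r; rewrite inE => /negbTE ->.
- by lia.
move=> n1 s1 hn1 [fr hE].
have hr1 := running_frame hr fr isT; have hm1 := r_mem hr1.
have hx1 : reg s1 rX = edge_at v by rewrite fr.2.
have hA1 : reg s1 rA = code_pvsym a by rewrite fr.2.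
have eU1 : reg s1 rU = node_at (lev lv p) by rewrite fr.2.
apply: wp_if; rewrite /= ?hm1 // ?hx1 ?(edge_unit he); first by lia.
  move=> /eqP h1; apply: (wp_unit_step hr1 hpq he hx1 hs h1 hA1 hva); lia.
move=> /eqP h1.
apply: wp_if; rewrite /= ?hm1 // ?eU1; first by lia.
  move=> /(sl_bad nu) hb; apply: (wp_leaf_step hr1 hpq he hx1 hs) => //; last by lia.
  by right=> -[].
move=> hb1.
apply: wp_if; rewrite /= ?hm1 // ?hm1 // ?hx1 ?(edge_to he); first by lia.
  move=> /(sl_bad nv) hb; apply: (wp_leaf_step hr1 hpq he hx1 hs) => //; last by lia.
  by right=> -[].
move=> hb2; apply: (wp_push hr1 hpq he hv hx1 hs) => //; last by lia.
case=> // h; apply: h; split; apply: contrapT.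
  by move/(sl_bad nu) => h; rewrite h in hb1.
by move/(sl_bad nv) => h; rewrite h in hb2.
Qed.

Lemma wp_body n s mk lv p0 p q st debt : running n s mk lv p0 p q st debt ->
  wp Wb c_body n.-1 s main_inv.
Proof.
move=> hr; have hm := r_mem hr; have hle := r_le hr; have hpq := r_pq hr.
have hc1 := running_n hr; rewrite /body_cost in hc1.
apply: wp_if; rewrite /= ?(r_p hr) ?(r_q hr); first by lia.
  move=> lt; have {}lt : p < q by lia.
  have [nu eU] := r_u hr lt.
  have [a [ha ea]] := @lev_rcons _ X lv p ltac:(lia) ltac:(lia).
  have hsz := @size_lev _ X lv p ltac:(lia).
  have [b hb] := @onth_ex _ X p ltac:(lia).
  have eab : a = zap (p - lv) b.
    move: ha; rewrite onth_iter_sl // subnKC; last by lia.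
    by rewrite hb /= => -[].
  apply: wp_seq; apply: (wp_call (t := 3)
    (P := fun s' => frame [:: rA] s s' /\ reg s' rA = code_pvsym a)).
  - have eb : arr s 14 (reg s 8 + 1) = code_pvsym b.
      by rewrite (r_p hr) -(r_pre hr hb); congr (arr s 14 _); lia.
    have bw : in_word Wb (code_pvsym b).
      apply: in_wordP; have := vX hb; case: (b) => [c _|k /=].
        by rewrite /code_pvsym; have : enum_rank c < Wb by [exact: leq_trans (ltn_ord _) hSb]; lia.
      by case: ltnP => [h [e]|h _]; lia.
    apply: wp_seq; apply: wp_set => //=; rewrite eb //.
    apply: wp_if => //=; rewrite (r_p hr) (r_lv hr) => h.
      apply: wp_skip => //; split; first by split=> //= r; rewrite inE => /negbTE ->.
      rewrite /= eab; case: b h {hb eab eb bw} => //= k h; rewrite ifF //; lia.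
    apply: wp_set => //=; split; first by split=> //= r; rewrite inE => /negbTE ->.
    by rewrite /= eab; case: b h {hb eab eb bw} => //= k h; [lia|rewrite ifT //; lia].
  - by lia.
  move=> n1 s1 hn1 [fr hA].
  have hr1 := running_frame hr fr isT; have hm1 := r_mem hr1.
  have eU1 : reg s1 rU = node_at (lev lv p) by rewrite fr.2.
  apply: wp_seq; apply: (wp_call (wp_search nu hm1 eU1 hA)); first by lia.
  move=> n2 s2 hn2 [fr2 H].
  have hr2 := running_frame hr1 fr2 isT.
  rewrite hsz in H.
  apply: wp_if => /=; first by lia.
    move=> hx; case: H => [[_ hno]|[v [he _ ex]]]; last first.
      by have [] := hedge he; lia.
    apply: wp_seq; apply: wp_set => /=; [by lia|by inword|].
    apply: wp_seq; apply: wp_set => /=; [by lia|by inword|].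
    apply: wp_set => /=; [by lia|by inword|].
    right; split=> //=; first by lia.
    (* Were the next prefix in the trie, its suffix at level [lv] would be too, and it would provide
       the missing edge. *)
    split=> // om; have op : ok p.+1 by apply: ok_le om; lia.
    have [|v he hv] := @child_exists _ _ T (lev lv p) a nu.
      by rewrite -ea; apply: PrevSub_iter_sl.
    by case: (hno v he); rewrite -hsz.
  move=> hx; case: H => [[ex _]|[v [he hv ex]]]; first by rewrite ex in hx.
  apply: (wp_edge hr2 lt he ha hv ex); last by lia.
  by rewrite fr2.2.
move=> h; have ? : p = q by lia.
subst q; have := wp_pop hr.
by have -> : n.-2 = n - 2 by lia.
Qed.

End Memory.

(** * Computing [pre P] in linear time *)

Section Preprocess.
Variables (Sigma Pi : finType) (P : pstring Sigma Pi) (W Wb : nat) (s : state).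
Hypotheses (hlen : reg s rLen = Posz (size P)) (hPW : size P <= W).
Hypothesis hP : forall i x, onth P i = Some x -> arr s aPattern (Posz i.+1) = code_psym x.
Hypotheses (hWb : 4 * W + 4 <= Wb) (hSb : #|Sigma| <= Wb) (hPb : #|Pi| <= Wb).
Local Notation m := (size P).

Definition pre_cost := 3 * #|Pi| + 10 * m + 4.

Lemma code_psym_inr (b : Pi) : @code_psym Sigma Pi (inr b) = Posz (enum_rank b).
Proof. by []. Qed.

Lemma wp_put_eq n s1 a e1 e2 z1 z2 Q : eval s1 e1 = z1 -> eval s1 e2 = z2 ->
  0 < n -> in_word Wb z1 -> in_word Wb z2 -> Q n.-1 (set_cell s1 a z1 z2) ->
  wp Wb (Put a e1 e2) n s1 Q.
Proof. by move=> <- <-; apply: wp_put. Qed.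

Lemma int_succ k : (Posz k + 1 = Posz k.+1)%R.
Proof. by lia. Qed.

(** [aLast] holds [lastpos] for every parameter. Memory is arbitrary at the start, so it is cleared
    first, at a cost proportional to [#|Pi|]. *)
Lemma wp_pre : wp Wb (c_pre #|Pi|) pre_cost s (fun _ s' =>
  [/\ forall a i, a < 14 -> arr s' a i = arr s a i,
      forall r, r != rI -> r != rA -> reg s' r = reg s r,
      pre_mem (pre P) s' & mk_mem (pre P) (fun _ => 0) s']).
Proof.
rewrite /c_pre; apply: wp_seq; apply: wp_set => //=; first by rewrite /pre_cost; lia.
pose I1 n s' := exists k, [/\ k <= #|Pi|, reg s' rI = Posz k,
  (forall a i, a < 14 -> arr s' a i = arr s a i),
  (forall r, r != rI -> reg s' r = reg s r)
  & (forall j, j < k -> arr s' aLast (Posz j) = 0%R) /\ 3 * (#|Pi| - k) + 10 * m + 3 <= n].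
have en : pre_cost.-1 = 3 * (#|Pi| - 0) + 10 * m + 3 by rewrite /pre_cost; lia.
apply: wp_seq; apply: (@wp_while _ I1); last first.
  exists 0; split=> //; first by move=> r /negbTE h /=; rewrite h.
  by split=> //; rewrite en.
move=> n s1 [k [hk e1 e2 e3 [e4 hn]]]; split; first by lia.
have -> : eval_test s1 (TLt (Reg rI) (Cst (Posz #|Pi|))) = (k < #|Pi|).
  by rewrite /= e1 ltz_nat.
case: ltnP (hk) => hk2 _; last first.
  have ? : k = #|Pi| by lia.
  subst k.
  apply: wp_seq; apply: wp_set => //=; first by lia.
  pose I2 n s' := exists i, [/\ i <= m, reg s' rI = Posz i,
    (forall a i, a < 14 -> arr s' a i = arr s a i) /\
    (forall r, r != rI -> r != rA -> reg s' r = reg s r),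
    (forall b : Pi, arr s' aLast (Posz (enum_rank b)) = Posz (lastpos P (inr b) i.+1)) /\
    (forall j, j < i -> arr s' aMk (Posz j.+1) = 0%R /\
       forall x, onth (pre P) j = Some x -> arr s' aPre (Posz j.+1) = code_pvsym x)
    & 10 * (m - i) < n].
  apply: (@wp_while _ I2); last first.
    exists 0; split=> //=; [|split=> // b|lia].
      by split=> // r h1 h2; rewrite (negbTE h1) e3.
    by rewrite lastpos0 e4 //; apply: ltn_ord.
  move=> {hk hk2 e1 e2 e3 e4 hn en} n' s2 [i [hi e1 [e2 e3] [e4 e5] hn]]; split; first by lia.
  rewrite /= e1 (e3 rLen) // hlen; case: (ltnP i m) => him; last first.
    have ? : i = m by lia.
    subst i; rewrite ifF; last by lia.
    split=> //.
      by move=> j x hx; apply: (e5 j _).2 => //; have := onth_size hx; rewrite size_pre.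
    by move=> j hj; rewrite size_pre in hj; split=> //; apply: (e5 j hj).1.
  rewrite ifT; last by lia.
  have [x hx] := onth_ex him.
  have e6 : arr s2 aPattern (Posz i.+1) = code_psym x by rewrite e2 ?(hP hx).
  have xw : in_word Wb (code_psym x).
    apply: in_wordP; case: (x) => [c|b]; rewrite /code_psym.
      have : enum_rank c < Wb by [exact: leq_trans (ltn_ord _) hSb]; lia.
    have : enum_rank b < Wb by [exact: leq_trans (ltn_ord _) hPb]; lia.
  apply: wp_seq; apply: wp_set; rewrite /= ?e1 ?int_succ; [by lia|by inword|].
  apply: wp_seq; apply: wp_put; rewrite /= ?e1 ?int_succ; [by lia|by inword|by inword|].
  apply: wp_seq; apply: wp_set; rewrite /= ?e6 //; first by lia.
  set s3 := set_reg _ _ _.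
  have r3 : reg s3 rI = Posz i.+1 by [].
  have c3 : reg s3 rA = code_psym x by [].
  have l3 j : arr s3 aLast j = arr s2 aLast j by [].
  have fin y n3 s4 : reg s4 = reg s3 ->
      (forall a j, a != aLast -> arr s4 a j = arr (set_cell s3 aPre (Posz i.+1) y) a j) ->
      (forall b : Pi, arr s4 aLast (Posz (enum_rank b)) = Posz (lastpos P (inr b) i.+2)) ->
      code_pvsym (pre_sym P i.+1 x) = y -> 10 * (m - i.+1) < n3 -> I2 n3 s4.
    move=> hr ha hl hy hn3; exists i.+1; split=> //.
    - by rewrite hr.
    - split=> [a j h|r h1 h2]; last by rewrite hr /= (negbTE h1) (negbTE h2) e3.
      have hk k : 14 <= k -> (a == k) = false by lia.
      by rewrite ha /= ?hk //= e2.
    - split=> // j hj; have [hj1|hj1] : j < i \/ j = i by lia.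
        have [h1 h2] := e5 j hj1.
        have hne : (Posz j.+1 == Posz i.+1) = false by lia.
        by split=> [|z hz]; rewrite ha //= hne ?h1 ?(h2 _ hz).
      subst j; split; first by rewrite ha //= eqxx.
      by move=> z; rewrite onth_pre hx => -[<-]; rewrite ha //= eqxx.
  apply: wp_if; first by lia.
    rewrite -[eval_test _ _]/(reg s3 rA < 0)%R c3 => neg.
    have [c ec] : exists c, x = inl c by case: (x) neg => [c _|b]; [exists c|rewrite code_psym_inr; lia].
    apply: (wp_put_eq (e1 := Reg rI) (e2 := Reg rA) r3 c3); [by lia|by inword|by []|].
    apply: (fin (code_psym x)) => //.
    + by move=> b; rewrite lastposS hx ec /= e4.
    + by rewrite ec.
    + by lia.
  rewrite -[~~ _]/(~~ (reg s3 rA < 0)%R) c3 => neg.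
  have [b eb] : exists b, x = inr b by case: (x) neg => [c|b _]; [rewrite /code_psym; lia|exists b].
  rewrite eb code_psym_inr in c3.
  have hpre := pre_symE b (ltnW him).
  have last_upd s4 : arr s4 aLast = arr s2 aLast -> forall b' : Pi,
      arr (set_cell s4 aLast (Posz (enum_rank b)) (Posz i.+1)) aLast (Posz (enum_rank b'))
      = Posz (lastpos P (inr b') i.+2).
    move=> h b'; rewrite lastposS hx eb.
    have -> z y z' : arr (set_cell s4 aLast z y) aLast z' = if z' == z then y else arr s4 aLast z'.
      by [].
    have -> : (Posz (enum_rank b') == Posz (enum_rank b)) = (b' == b).
      by rewrite eqz_nat (inj_eq val_inj) (inj_eq enum_rank_inj).
    have -> : (Some (inr b : Sigma + Pi) == Some (inr b')) = (b' == b) by rewrite eq_sym.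
    by case: ifP => // _; rewrite h e4.
  have lp : lastpos P (inr b) i.+1 <= i.
    by case: (lastposP P (inr b) i) => [[-> //]|[j -> [h _ _]]].
  have bw : in_word Wb (Posz (enum_rank b)).
    apply: in_wordP; have : enum_rank b < Wb by [exact: leq_trans (ltn_ord _) hPb]; lia.
  have el : arr s3 aLast (reg s3 rA) = Posz (lastpos P (inr b) i.+1) by rewrite c3 l3 e4.
  apply: wp_seq; apply: wp_if; first by lia.
    rewrite -[eval_test _ _]/(arr s3 aLast (reg s3 rA) == 0)%R el => /eqP[z].
    apply: (wp_put_eq (e1 := Reg rI) (e2 := Cst 0) r3 (erefl 0%R)); [by lia|by inword|by inword|].
    apply: wp_put_eq; [exact: c3|exact: r3|by lia|by []|by inword|].
    apply: (fin 0%R) => //.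
    + by move=> a j /negbTE h /=; rewrite h.
    + exact: last_upd.
    + by rewrite eb hpre z.
    + by lia.
  rewrite -[eval_test _ _]/(arr s3 aLast (reg s3 rA) == 0)%R el => z.
  have ev : eval s3 (Minus (Reg rI) (Get aLast (Reg rA)))
      = Posz (i.+1 - lastpos P (inr b) i.+1).
    by rewrite (_ : eval s3 _ = (reg s3 rI - arr s3 aLast (reg s3 rA))%R) // el r3; lia.
  apply: (wp_put_eq (e1 := Reg rI) r3 ev); [by lia|by inword|by inword|].
  apply: wp_put_eq; [exact: c3|exact: r3|by lia|by []|by inword|].
  apply: (fin (Posz (i.+1 - lastpos P (inr b) i.+1))) => //.
  + by move=> a j /negbTE h /=; rewrite h.
  + exact: last_upd.
  + by rewrite eb hpre /= ifF //; lia.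
  + by lia.
apply: wp_seq; apply: wp_put; rewrite /= ?e1; [by lia|by inword|by inword|].
apply: wp_set; rewrite /= ?e1 ?int_succ; [by lia|by inword|].
exists k.+1; split=> //.
- move=> a i h /=; have -> : (a == 15) = false by lia.
  exact: e2.
- by move=> r h /=; rewrite (negbTE h) e3.
split; last by lia.
move=> j hj /=; case: eqP => [//|hne]; apply: e4.
have : j <> k by move=> ejk; apply: hne; rewrite ejk.
lia.
Qed.

End Preprocess.

(** * Assembling the time bound *)

Lemma max_prefix (f : nat -> Prop) n : f 0 -> (forall i j, i <= j -> f j -> f i) ->
  exists M, M <= n /\ forall i, i <= n -> f i <-> i <= M.
Proof.
move=> f0 fle; elim: n => [|n [M [hM h]]].
  by exists 0; split=> // i; rewrite leqn0 => /eqP ->.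
case: (EM (f n.+1)) => fn.
  by exists n.+1; split=> // i hi; split=> // _; apply: fle fn.
exists M; split=> [|i]; first by lia.
rewrite leq_eqVlt => /orP[/eqP ->|]; last exact: h.
by split=> // hi; lia.
Qed.

Lemma pre_iter_zeros (Sigma Pi : finType) (P : pstring Sigma Pi) k :
  count_mem (inr 0) (iter k sl (pre P)) <= #|Pi|.
Proof.
have -> : iter k sl (pre P) = pre (iter k behead P).
  by elim: k => //= k ->; rewrite pre_behead.
exact: pre_zeros.
Qed.

Theorem theorem1 (Sigma Pi : finType) :
  exists (prog : cmd) (c : nat),
    forall (T P : pstring Sigma Pi) (d : Sigma) (s : state) (W : nat),
      ends_with_sentinel d T ->
      stores_PLST T s ->
      stores_pattern P s ->
      word_state W s ->
      exists (t : nat) (s' : state),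
        [/\ exec (c * W.+1) prog s t s',
            (t <= c * (size P).+1)%N
          & reg s' rOut = 1%R <-> has_pmatching_substring T P].
Proof.
pose k1 := body_cost Sigma Pi.
(* The last summand is the price per symbol from [Phi_total] with [z = #|Pi|]. The rest pays for
   preprocessing and the final round, and lets symbol codes and sums of a few words fit in
   [c * W.+1]. *)
pose c := 40 + #|Sigma| + 4 * #|Pi| + k1 + (3 * k1 + 20 + 2 * k1 * (#|Pi| + 4)).
exists (c_main #|Pi|), c => T P d s W _ [node_at [edge_at [T' [hnode hedge hinj [_ htext] hroot]]]].
move=> [hlen hpat] [wreg warr].
set Wb := c * W.+1.
have hcW : c + c * W = Wb by rewrite /Wb mulnS.
have hWb : 4 * W + 4 <= Wb by rewrite /Wb /c; nia.
have hSb : #|Sigma| <= Wb by rewrite -hcW /c; lia.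
have hPb : #|Pi| <= Wb by rewrite -hcW /c; lia.
have hPW : size P <= W by have := wreg rLen; rewrite /in_word hlen; lia.
have vX := @valid_pre _ _ P.
have hXW : size (pre P) <= W by rewrite size_pre.
have ok0 : ok T (pre P) 0 by rewrite /ok take0; apply: PrevSub_nil.
have [M [hMm hM]] := max_prefix (size (pre P)) ok0 (@ok_le _ _ T (pre P)).
have okE : ok T (pre P) (size (pre P)) <-> has_pmatching_substring T P.
  by rewrite has_pmatching_PrevSub /ok take_size.
suff [t [s' [h1 h2 h3]]] : wp Wb (c_main #|Pi|) (c * (size P).+1) s
    (fun _ s' => reg s' rOut = 1%R <-> ok T (pre P) (size (pre P))).
  by exists t, s'; split=> //; rewrite h3.
have hc1 := @body_cost_ge Sigma Pi; rewrite -/k1 in hc1.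
have hphi := Phi_total T (3 * k1 + 20) (2 * k1) hMm (pre_iter_zeros P).
rewrite size_pre in hphi.
pose n1 := (3 * k1 + 20 + 2 * k1 * (#|Pi| + 4)) * size P + k1.
have hn : pre_cost P + 6 + n1 <= c * (size P).+1.
  suff bound y z : 10 <= y -> 3 * #|Pi| + 10 + k1 <= y ->
      pre_cost P + 6 + (z * size P + k1) <= (y + z) * (size P).+1.
    by apply: bound; lia.
  move=> y10 yb; have := leq_mul y10 (leqnn (size P)).
  by rewrite /pre_cost mulnDl !mulnS; clear -yb; lia.
apply: wp_seq; apply: (wp_call (wp_pre hlen hPW hpat hWb hSb hPb)); first by lia.
move=> n s1 hn1 [ha hr hpre hmk].
have wr : in_word Wb (reg s rRoot) by apply: in_wordP; have := wreg rRoot; rewrite /in_word ler_norml; lia.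
apply: wp_seq; apply: wp_set => //=; first by lia.
apply: wp_seq; apply: wp_set; rewrite /= ?(hr rRoot) //; first by lia.
apply: wp_seq; apply: wp_set; rewrite /= ?(hr rLen) ?hlen //; [by lia|by apply: in_wordP; lia|].
apply: wp_seq; apply: wp_set => //=; first by lia.
apply: wp_seq; apply: wp_set => //=; first by lia.
apply: wp_seq; apply: wp_set => //=; first by lia.
apply: (@wp_while _ (main_inv T s node_at Wb (pre P) M)).
  move=> n2 s2 [[mk [lv [p0 [p [q [st [debt run]]]]]]]|[g0 n0 ho]]; last first.
    by split; rewrite //= g0.
  have hc : k1 <= n2 by apply: running_n run; eassumption.
  split; first by lia.
  rewrite /= (r_go run) /=.
  exact: (wp_body hnode hedge htext warr hWb hSb vX hXW hM hMm run).
left; exists (fun _ => 0), 0, 0, 0, (size (pre P)), [::], false.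
split=> //=; rewrite ?size_pre ?hlen //.
- move=> _; rewrite /level take0 /=; split=> //; exact: node_nil.
rewrite addn0 muln1 addn0; apply: leq_trans (leq_add hphi (leqnn _)) _; lia.
Qed.
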